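(* Let $(R,\mathfrak m)$ be a local ring and $M\neq 0$ a finitely generated $R$-module of dimension $d$. If $M$ is Cohen-Macaulay, then $H_{\mathfrak m}^d(M)$ is co-Cohen-Macaulay of N.dimension $d$, i.e. $\mathrm{width}_R(H_{\mathfrak m}^d(M))=\mathrm{N.dim}_R(H_{\mathfrak m}^d(M))=d$.
   Context: Local ring means commutative Noetherian local ring. $H^d_{\mathfrak m}(M)$ is the $d$-th local cohomology module of $M$ with respect to $\mathfrak m$ (an Artinian $R$-module). Let $(A,\mathfrak n)$ be a commutative quasi-local ring and $X$ an Artinian $A$-module. The N.dimension (Noetherian dimension) $\mathrm{N.dim}_A(X)$ is defined inductively: $\mathrm{N.dim}_A(X)=-1$ when $X=0$; for an integer $r\ge 0$, put $\mathrm{N.dim}_A(X)=r$ when $\mathrm{N.dim}_A(X)<r$ is false and for every ascending chain $X_0\subseteq X_1\subseteq X_2\subseteq\cdots$ of submodules of $X$ there exists an integer $n$ such that $\mathrm{N.dim}_A(X_{m+1}/X_m)<r$ for all $m\ge n$. A sequence $x_1,\ldots,x_n\in\mathfrak n$ is $X$-coregular if multiplication by $x_i$ on $0:_X(x_1,\ldots,x_{i-1})$ is surjective for $i=1,\ldots,n$, where $0:_X(y_1,\ldots,y_k)=\{u\in X: y_1u=\cdots=y_ku=0\}$ (and this is $X$ when $k=0$). The width $\mathrm{width}_A(X)$ is the length of a maximal $X$-coregular sequence in $\mathfrak n$. $X$ is co-Cohen-Macaulay if $\mathrm{width}_A(X)=\mathrm{N.dim}_A(X)$. *)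

(* Defs.v *)
From HB Require Import structures.
From mathcomp Require Import all_boot all_algebra.
From mathcomp Require Import boolp.

Set Implicit Arguments.
Unset Strict Implicit.
Unset Printing Implicit Defensive.

Import GRing.Theory.
Local Open Scope ring_scope.
Local Open Scope quotient_scope.

(* A submodule of V is a [submodClosed V]; an ideal of R that may be improper
   is a submodule of R^o, whereas the ideals of type [idealr R] and
   [prime_idealr R] are proper. *)

Section Submodule.
Context {R : pzRingType} {V : lmodType R} (S : submodClosed V).

Record submod : Type := Submod { submod_val : V; _ : submod_val \in S }.

HB.instance Definition _ := [isSub for submod_val].
HB.instance Definition _ := [Choice of submod by <:].

Let submod_zmod_closed : zmod_closed S.
Proof.
split=> [|u v Su Sv]; first by rewrite rpred0.
by rewrite -scaleN1r rpredD // rpredZ.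
Qed.

HB.instance Definition _ :=
  GRing.SubChoice_isSubZmodule.Build V _ submod submod_zmod_closed.
HB.instance Definition _ :=
  GRing.SubZmodule_isSubLmodule.Build R V _ submod
    (GRing.subsemimodClosedP S).

End Submodule.

Section QuotientModule.
Context {R : pzRingType} {V : lmodType R} (S : submodClosed V).

Definition quotmod_rel (u v : V) : bool := u - v \in S.

Lemma quotmod_rel_equiv : equiv_class_of quotmod_rel.
Proof.
have oppS : forall u v : V, u - v \in S -> v - u \in S.
  by move=> u v Suv; rewrite -opprB -scaleN1r rpredZ.
rewrite /quotmod_rel; split=> [u|u v|v u w Suv Svw].
- by rewrite subrr rpred0.
- by apply/idP/idP; apply: oppS.
- by rewrite -[u](subrK v) -addrA rpredD.
Qed.

Canonical quotmod_equiv := EquivRelPack quotmod_rel_equiv.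
Canonical quotmod_encModRel := defaultEncModRel quotmod_rel.

Definition quotmod : Type := {eq_quot quotmod_rel}.

HB.instance Definition _ : EqQuotient V quotmod_rel quotmod :=
  EqQuotient.on quotmod.
HB.instance Definition _ := Choice.on quotmod.

Definition quotmod_pi (u : V) : quotmod := \pi_quotmod u.

Local Notation pi := quotmod_pi.
Let rep (x : quotmod) : V := repr x.

Lemma quotmodP (u v : V) : quotmod_pi u = quotmod_pi v <-> u - v \in S.
Proof. by split=> [/eqquotP|Suv] //; apply/eqquotP. Qed.

Let repK x : pi (rep x) = x. Proof. exact: reprK. Qed.

Let rep_piB u : rep (pi u) - u \in S.
Proof. by apply/quotmodP; rewrite repK. Qed.

Let quot_add x y := pi (rep x + rep y).
Let quot_opp x := pi (- rep x).
Let quot_scale (a : R) x := pi (a *: rep x).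

Let quot_addE u v : quot_add (pi u) (pi v) = pi (u + v).
Proof. by apply/quotmodP; rewrite opprD addrACA rpredD. Qed.

Let quot_oppE u : quot_opp (pi u) = pi (- u).
Proof. by apply/quotmodP; rewrite -opprD -[- (_ - _)]scaleN1r rpredZ. Qed.

Let quot_scaleE a u : quot_scale a (pi u) = pi (a *: u).
Proof. by apply/quotmodP; rewrite -scalerBr rpredZ. Qed.

Let quot_addA : associative quot_add.
Proof.
by move=> x y z; rewrite -(repK x) -(repK y) -(repK z) !quot_addE addrA.
Qed.

Let quot_addC : commutative quot_add.
Proof. by move=> x y; rewrite -(repK x) -(repK y) !quot_addE addrC. Qed.

Let quot_add0 : left_id (pi 0) quot_add.
Proof. by move=> x; rewrite -(repK x) quot_addE add0r. Qed.

Let quot_addN : left_inverse (pi 0) quot_opp quot_add.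
Proof. by move=> x; rewrite -(repK x) quot_oppE quot_addE addNr. Qed.

HB.instance Definition _ :=
  GRing.isZmodule.Build quotmod quot_addA quot_addC quot_add0 quot_addN.

Let quot_scaleA a b x : quot_scale a (quot_scale b x) = quot_scale (a * b) x.
Proof. by rewrite -(repK x) !quot_scaleE scalerA. Qed.

Let quot_scale1 : left_id 1 quot_scale.
Proof. by move=> x; rewrite -(repK x) quot_scaleE scale1r. Qed.

Let quot_scaleDr : right_distributive quot_scale +%R.
Proof.
move=> a x y; rewrite -(repK x) -(repK y).
have -> : pi (rep x) + pi (rep y) = pi (rep x + rep y) by exact: quot_addE.
by rewrite !quot_scaleE scalerDr; symmetry; exact: quot_addE.
Qed.

Let quot_scaleDl x : {morph quot_scale^~ x : a b / a + b}.
Proof.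
move=> a b; rewrite -(repK x) !quot_scaleE scalerDl.
by symmetry; exact: quot_addE.
Qed.

HB.instance Definition _ :=
  GRing.Zmodule_isLmodule.Build R quotmod
    quot_scaleA quot_scale1 quot_scaleDr quot_scaleDl.

Lemma quotmod_pi_linear : linear quotmod_pi.
Proof.
move=> a u v; symmetry.
have -> : a *: pi u = pi (a *: u) by exact: quot_scaleE.
exact: quot_addE.
Qed.

HB.instance Definition _ :=
  GRing.isLinear.Build R V quotmod _ quotmod_pi quotmod_pi_linear.

End QuotientModule.

Section Submodules.
Context {R : pzRingType} {U V : lmodType R}.

Definition zero_submod : {pred V} := pred1 0.

Lemma zero_submod_closed : submod_closed zero_submod.
Proof.
split=> [|a u v]; rewrite !inE // => /eqP-> /eqP->.
by rewrite scaler0 addr0.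
Qed.
HB.instance Definition _ :=
  GRing.isSubmodClosed.Build R V zero_submod zero_submod_closed.

Variable f : {linear U -> V}.

Definition ker_submod : {pred U} := [pred u | f u == 0].

Lemma ker_submod_closed : submod_closed ker_submod.
Proof.
split=> [|a u v]; rewrite !inE ?linear0 // => /eqP fu /eqP fv.
by rewrite linearP fu fv scaler0 addr0.
Qed.
HB.instance Definition _ :=
  GRing.isSubmodClosed.Build R U ker_submod ker_submod_closed.

Definition im_submod : {pred V} := [pred v | `[< exists u, f u = v >]].

Lemma im_submod_closed : submod_closed im_submod.
Proof.
split=> [|a v w]; rewrite !inE; first by apply/asboolP; exists 0; exact: linear0.
move=> /asboolP[u1 <-] /asboolP[u2 <-]; apply/asboolP.
by exists (a *: u1 + u2); rewrite linearP.
Qed.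
HB.instance Definition _ :=
  GRing.isSubmodClosed.Build R V im_submod im_submod_closed.

Definition preim_submod (S : submodClosed V) : {pred U} := [pred u | f u \in S].

Lemma preim_submod_closed S : submod_closed (preim_submod S).
Proof.
split=> [|a u v]; rewrite !inE ?linear0 ?rpred0 // => Su Sv.
by rewrite linearP rpredD // rpredZ.
Qed.
HB.instance Definition _ S :=
  GRing.isSubmodClosed.Build R U (preim_submod S) (preim_submod_closed S).

End Submodules.

(* P / Q for submodules Q <= P of V; without this inclusion it is
   P / (P :&: Q). *)
Definition subquot (R : pzRingType) (V : lmodType R) (P Q : submodClosed V) :
    lmodType R :=
  quotmod (preim_submod (val : {linear submod P -> V}) Q).

Section RingsAndModules.
Context {R : comNzRingType}.

Definition maximal_ideal (m : idealr R) : Prop :=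
  forall I : idealr R, {subset m <= I} -> {subset I <= m}.

Definition local_ring (m : idealr R) : Prop :=
  maximal_ideal m /\ forall I : idealr R, maximal_ideal I -> I =i m.

Definition finitely_generated (V : lmodType R) : Prop :=
  exists (n : nat) (e : 'I_n -> V),
    forall v, exists c : 'I_n -> R, v = \sum_(i < n) c i *: e i.

Definition noetherian_ring : Prop :=
  forall I : submodClosed R^o, finitely_generated (submod I).

Definition artinian (V : lmodType R) : Prop :=
  forall X : nat -> submodClosed V,
    (forall i, {subset X i.+1 <= X i}) ->
    exists n, forall k, (n <= k)%N -> X k =i X n.

(* dim M is the Krull dimension of R / Ann M: the primes of this ring
   correspond to the primes of R containing Ann M. *)
Definition annihilates (M : lmodType R) (a : R) : Prop :=
  forall u : M, a *: u = 0.

Definition prime_chain (M : lmodType R) (n : nat) : Prop :=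
  exists p : 'I_n.+1 -> prime_idealr R,
    (forall i a, annihilates M a -> a \in p i) /\
    (forall i j : 'I_n.+1, (i < j)%N ->
       {subset p i <= p j} /\ ~ {subset p j <= p i}).

Definition is_krull_dim (M : lmodType R) (d : nat) : Prop :=
  prime_chain M d /\ forall n, prime_chain M n -> (n <= d)%N.

(* v lies in (xs) V *)
Definition in_ideal_mul (V : lmodType R) (xs : seq R) (v : V) : Prop :=
  exists c : nat -> V, v = \sum_(i < size xs) xs`_i *: c i.

Definition regular_seq (m : idealr R) (M : lmodType R) (xs : seq R) : Prop :=
  [/\ all (mem m) xs,
      forall i, (i < size xs)%N -> forall u : M,
        in_ideal_mul (take i xs) (xs`_i *: u) -> in_ideal_mul (take i xs) u
    & exists u : M, ~ in_ideal_mul xs u].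

Definition is_depth (m : idealr R) (M : lmodType R) (n : nat) : Prop :=
  exists xs : seq R, [/\ regular_seq m M xs,
    forall y, y \in m -> ~ regular_seq m M (rcons xs y) & size xs = n].

Definition cohen_macaulay (m : idealr R) (M : lmodType R) : Prop :=
  exists n, is_depth m M n /\ is_krull_dim M n.

(* 0 :_X (xs) *)
Definition colon0 (X : lmodType R) (xs : seq R) : {pred X} :=
  [pred u | all (fun y => y *: u == 0) xs].
Arguments colon0 : clear implicits.

Definition coregular_seq (m : idealr R) (X : lmodType R) (xs : seq R) : Prop :=
  all (mem m) xs /\
  forall i, (i < size xs)%N -> forall u : X, u \in colon0 X (take i xs) ->
    exists2 v : X, v \in colon0 X (take i xs) & xs`_i *: v = u.

(* All maximal coregular sequences of an Artinian module over a local ring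
   have the same length, as do all maximal regular sequences of a finitely
   generated nonzero module, so [is_width] and [is_depth] are functional
   there. *)
Definition is_width (m : idealr R) (X : lmodType R) (n : nat) : Prop :=
  exists xs : seq R, [/\ coregular_seq m X xs,
    forall y, y \in m -> ~ coregular_seq m X (rcons xs y) & size xs = n].

Definition chain_quotients (P : lmodType R -> Prop) (X : lmodType R) : Prop :=
  forall Y : nat -> submodClosed X, (forall i, {subset Y i <= Y i.+1}) ->
    exists n, forall k, (n <= k)%N -> P (subquot (Y k.+1) (Y k)).

(* [Ndim_lt r X] says that N.dim X is one of -1, 0, ..., r - 1. *)
Fixpoint Ndim_lt (r : nat) (X : lmodType R) : Prop :=
  if r is s.+1 then
    Ndim_lt s X \/ ~ Ndim_lt s X /\ chain_quotients (Ndim_lt s) X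
  else forall u : X, u = 0.

Definition is_Ndim (X : lmodType R) (r : nat) : Prop :=
  ~ Ndim_lt r X /\ chain_quotients (Ndim_lt r) X.

(* For X = 0, where N.dim X = -1, every sequence in m is coregular and none is
   maximal, so n ranges over nat without loss. *)
Definition co_cohen_macaulay (m : idealr R) (X : lmodType R) : Prop :=
  artinian X /\ exists n, is_width m X n /\ is_Ndim X n.

End RingsAndModules.

Arguments noetherian_ring : clear implicits.
Arguments colon0 {R} X xs.

Record cochain (R : pzRingType) := Cochain {
  cochain_obj :> nat -> lmodType R;
  cochain_diff : forall n, {linear cochain_obj n -> cochain_obj n.+1};
  cochain_diffK : forall n u, cochain_diff n.+1 (cochain_diff n u) = 0 }.

Definition boundaries (R : pzRingType) (C : cochain R) (n : nat) :
    submodClosed (C n) :=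
  match n with
  | 0%N => zero_submod
  | k.+1 => im_submod (cochain_diff C k)
  end.

Definition cohomology (R : pzRingType) (C : cochain R) (n : nat) : lmodType R :=
  subquot (ker_submod (cochain_diff C n)) (boundaries C n).

Definition injective_module (R : pzRingType) (E : lmodType R) : Prop :=
  forall (A B : lmodType R) (i : {linear A -> B}) (f : {linear A -> E}),
    injective i -> exists g : {linear B -> E}, forall a, g (i a) = f a.

Definition injective_resolution (R : pzRingType) (M : lmodType R)
    (I : cochain R) (e : {linear M -> I 0%N}) : Prop :=
  [/\ forall n, injective_module (I n),
      injective e,
      ker_submod (cochain_diff I 0%N) =i im_submod e
    & forall n, ker_submod (cochain_diff I n.+1) =i im_submod (cochain_diff I n)].

Section Torsion.
Context {R : comNzRingType} (m : idealr R).

(* The elements of V killed by some power of m; m ^ k is generated by the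
   products of k elements of m. *)
Definition torsion (V : lmodType R) : {pred V} :=
  [pred v | `[< exists k : nat, forall a : 'I_k -> R,
                  (forall i, a i \in m) -> (\prod_(i < k) a i) *: v = 0 >]].
Arguments torsion : clear implicits.

Lemma torsion_closed V : submod_closed (torsion V).
Proof.
split=> [|a u v]; rewrite !inE.
  by apply/asboolP; exists 0%N => b _; rewrite scaler0.
move=> /asboolP[k ku] /asboolP[l lv]; apply/asboolP; exists (k + l)%N => b bm.
rewrite big_split_ord /=; set p := \prod_(_ < k) _; set q := \prod_(_ < l) _.
have pu : p *: u = 0 by exact: ku.
have qv : q *: v = 0 by exact: lv.
rewrite scalerDr -[in _ *: v]scalerA qv scaler0 addr0 scalerA.
by rewrite mulrC mulrCA mulrC -scalerA pu scaler0.
Qed.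
HB.instance Definition _ V :=
  GRing.isSubmodClosed.Build R V (torsion V) (torsion_closed V).

Variable C : cochain R.

Lemma torsion_diff_subproof n (u : submod (torsion (C n))) :
  cochain_diff C n (val u) \in torsion (C n.+1).
Proof.
have /asboolP[k ku] := valP u; apply/asboolP; exists k => b bm.
by rewrite -linearZ ku // linear0.
Qed.

Definition torsion_diff n (u : submod (torsion (C n))) :
    submod (torsion (C n.+1)) := Submod (torsion_diff_subproof u).

Lemma torsion_diff_linear n : linear (@torsion_diff n).
Proof. by move=> a u v; apply: val_inj; rewrite /= linearP. Qed.
HB.instance Definition _ n :=
  GRing.isLinear.Build R _ _ _ (@torsion_diff n) (@torsion_diff_linear n).

Lemma torsion_diffK n (u : submod (torsion (C n))) :
  torsion_diff (torsion_diff u) = 0.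
Proof. by apply: val_inj; rewrite /= cochain_diffK. Qed.

Definition torsion_cochain : cochain R :=
  @Cochain R (fun n => submod (torsion (C n)))
    (fun n => @torsion_diff n) (@torsion_diffK).

(* Local cohomology with respect to m is the right derived functor of the
   m-torsion functor: when C is an injective resolution of M this is
   H^n_m(M). *)
Definition local_cohomology (n : nat) : lmodType R :=
  cohomology torsion_cochain n.

End Torsion.

Arguments torsion {R} m V.

(* Main.v *)
Require Import Defs.
From HB Require Import structures.
From mathcomp Require Import all_boot all_algebra.
From mathcomp Require Import boolp.

Set Implicit Arguments.
Unset Strict Implicit.
Unset Printing Implicit Defensive.

Import GRing.Theory.
Local Open Scope ring_scope.

(** Let x_1, ..., x_d be an M-regular sequence of length d = dim M and put
    H = H^d_m(M).  The long exact sequence of local cohomology attached to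
    multiplication by x_1 on M shows that x_1 is surjective on H, with kernel
    H^(d-1)_m(M / x_1 M).  Repeating this, x_1, ..., x_d is coregular on H, and
    0 :_H (x_1, ..., x_d) is H^0_m of M' = M / (x_1, ..., x_d) M, that is M'
    itself: a nonzero finitely generated module killed by a power of m.  The
    predicate [tower] records this shape, and everything about H follows from
    it.

    - The sequence is maximal: an element of m is nilpotent on M', so it is not
      surjective there ([tower_maximal]).
    - If X is x-torsion and 0 :_X x is Artinian, then X is Artinian
      ([dcc_torsion]).  If X is Artinian and x-torsion, then
      N.dim X <= N.dim (0 :_X x) + 1 ([dev_torsion]); the opposite inequality
      holds when x is surjective on X ([dev_divisible]).  The proofs of the
      first two statements use the pieces x ^+ k (Y :&: (0 :_X x ^+ k.+1)) of a
      submodule Y of X, which decrease with k inside 0 :_X x ([lead]).  As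
      N.dim M' = 0, the dimension of H is d.
    - M' is killed by a power of m because m is the only prime containing
      Ann M': below any prime containing Ann (N / x N), with x regular on N,
      there is a strictly smaller one containing Ann N ([prime_below]), so
      another prime would give a chain of d + 1 steps ([system_kills]).

    The local cohomology of the successive quotients is computed from the given
    injective resolution of M.  If C is a complex of injective modules whose
    cohomology is N, placed in degree s, then the mapping cone of x on C is a
    complex of injective modules whose cohomology is N / x N, placed in degree
    s + 1 ([cone_resolves]).  Because of the shift, all the modules
    H^(d-i)_m(M / (x_1, ..., x_i) M) sit in the same degree d of complexes of
    torsion submodules, and the long exact sequence is a computation with pairs
    of cochains in the degrees d - 1, d and d + 1 ([vanishes_cone],
    [lc_divisible], [lc_kernel]).  The last complex K is exact below degree d,
    so it has a linear contraction there by injectivity ([contraction]).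
    Linear maps preserve m-torsion; hence the complex of torsion submodules of
    K is exact below degree d, and subtracting a boundary makes an element of
    K^d torsion as soon as a power of m sends it to the boundaries.  This gives
    H^d of the torsion of K as M', and the vanishing of H^(d+1)
    ([tower_last], [vanishes_above]). *)

(** * Submodules as predicates, linear relations *)

Section SubmodulePredicates.
Context {R : comNzRingType}.
Implicit Types V W : lmodType R.

(** Images, sums and infinite intersections of submodules are defined by
    quantifiers, so submodules are handled as predicates into Prop. *)
Definition is_submod V (S : V -> Prop) : Prop :=
  S 0 /\ forall a u v, S u -> S v -> S (a *: u + v).

Definition incl V (S T : V -> Prop) : Prop := forall u, S u -> T u.

Definition zerop V : V -> Prop := fun u => u = 0.
Definition fullp V : V -> Prop := fun=> True.
Definition sump V (S T : V -> Prop) : V -> Prop :=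
  fun u => exists2 t, T t & S (u - t).
Definition meetp V (S T : V -> Prop) : V -> Prop := fun u => S u /\ T u.
Definition scale_preim V (x : R) (S : V -> Prop) : V -> Prop :=
  fun u => S (x *: u).

(** The submodules of [V * W].  They stand for maps between subquotients of V
    and W, which they describe through representatives. *)
Definition linrel V W (g : V -> W -> Prop) : Prop :=
  g 0 0 /\ forall a u u' v v', g u v -> g u' v' -> g (a *: u + u') (a *: v + v').

Section Closure.
Variables (V : lmodType R) (S : V -> Prop) (hS : is_submod S).

Lemma is_submod0 : S 0. Proof. by case: hS. Qed.

Lemma is_submodZ a u : S u -> S (a *: u).
Proof. by case: hS => S0 SZD Su; rewrite -[_ *: u]addr0; apply: SZD. Qed.

Lemma is_submodD u v : S u -> S v -> S (u + v).
Proof. by case: hS => _ SZD Su Sv; rewrite -[u]scale1r; apply: SZD. Qed.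

Lemma is_submodN u : S u -> S (- u).
Proof. by rewrite -scaleN1r; apply: is_submodZ. Qed.

Lemma is_submodB u v : S u -> S v -> S (u - v).
Proof. by move=> Su Sv; apply: is_submodD => //; apply: is_submodN. Qed.

Lemma is_submodBC u v : S (u - v) -> S (v - u).
Proof. by move=> /is_submodN; rewrite opprB. Qed.

Lemma is_submodBr u v : S (u - v) -> S v -> S u.
Proof. by move=> Suv Sv; rewrite -[u](subrK v); apply: is_submodD. Qed.

Lemma is_submodBl u v : S (u - v) -> S u -> S v.
Proof. by move=> /is_submodBC; apply: is_submodBr. Qed.

End Closure.

Lemma submod_zerop V : is_submod (@zerop V).
Proof. by split=> // a u v -> ->; rewrite scaler0 addr0. Qed.

Lemma submod_fullp V : is_submod (@fullp V).
Proof. by []. Qed.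

Lemma submod_meetp V (S T : V -> Prop) :
  is_submod S -> is_submod T -> is_submod (meetp S T).
Proof.
move=> [S0 SD] [T0 TD]; split=> // a u v [Su Tu] [Sv Tv].
by split; [apply: SD | apply: TD].
Qed.

Lemma submod_sump V (S T : V -> Prop) :
  is_submod S -> is_submod T -> is_submod (sump S T).
Proof.
move=> hS hT; split=> [|a u v [t Tt St] [t' Tt' St']].
  by exists 0; rewrite ?subr0; apply: is_submod0.
exists (a *: t + t'); first by apply: hT.2.
rewrite opprD addrACA -scalerBr; exact: hS.2.
Qed.

Lemma submod_scale_preim V (x : R) (S : V -> Prop) :
  is_submod S -> is_submod (scale_preim x S).
Proof.
move=> hS; split=> [|a u v]; rewrite /scale_preim ?scaler0.
  exact: is_submod0.
by move=> Su Sv; rewrite scalerDr scalerA mulrC -scalerA; apply: hS.2.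
Qed.

Lemma submod_mem V (S : submodClosed V) : is_submod (fun u => u \in S).
Proof. by split=> [|a u v Su Sv]; rewrite ?rpred0 ?rpredD ?rpredZ. Qed.

Lemma sumpl V (S T : V -> Prop) : is_submod T -> incl S (sump S T).
Proof. by move=> hT u Su; exists 0; rewrite ?subr0 //; apply: is_submod0. Qed.

Lemma sumpr V (S T : V -> Prop) : is_submod S -> incl T (sump S T).
Proof. by move=> hS u Tu; exists u => //; rewrite subrr; apply: is_submod0. Qed.

Definition asbool_submod V (S : V -> Prop) (hS : is_submod S) : {pred V} :=
  [pred u | `[< S u >]].

Lemma asbool_submod_closed V (S : V -> Prop) (hS : is_submod S) :
  submod_closed (asbool_submod hS).
Proof.
split=> [|a u v]; rewrite !inE; first by apply/asboolP; apply: is_submod0.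
by move=> /asboolP Su /asboolP Sv; apply/asboolP; apply: hS.2.
Qed.
HB.instance Definition _ V (S : V -> Prop) (hS : is_submod S) :=
  GRing.isSubmodClosed.Build R V (asbool_submod hS) (asbool_submod_closed hS).

Lemma asbool_submodE V (S : V -> Prop) (hS : is_submod S) u :
  u \in asbool_submod hS <-> S u.
Proof. by rewrite inE; split=> /asboolP. Qed.

Lemma linrel_map V W (f : {linear V -> W}) : linrel (fun u v => v = f u).
Proof. by split=> [|a u u' v v' -> ->]; rewrite ?linear0 ?linearP. Qed.

Lemma linrelZ V W (g : V -> W -> Prop) a u v :
  linrel g -> g u v -> g (a *: u) (a *: v).
Proof.
by move=> [g0 gP] guv; rewrite -[a *: u]addr0 -[a *: v]addr0; apply: gP.
Qed.

Lemma linrelB V W (g : V -> W -> Prop) u u' v v' :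
  linrel g -> g u v -> g u' v' -> g (u - u') (v - v').
Proof.
move=> [_ gP] guv guv'; have := gP (-1) _ _ _ _ guv' guv.
by rewrite !scaleN1r ![- _ + _]addrC.
Qed.

(** Maps defined on an image or with values in a quotient are first given by
    relations; choice turns these into linear maps. *)
Lemma linrel_fun V W (g : V -> W -> Prop) : linrel g ->
  (forall u, exists v, g u v) -> (forall v, g 0 v -> v = 0) ->
  exists f : {linear V -> W}, forall u, g u (f u).
Proof.
move=> lg tot sv; have [f fP] := choice tot.
have uniq u v w : g u v -> g u w -> v = w.
  move=> guv guw; apply/eqP; rewrite -subr_eq0; apply/eqP/sv.
  by rewrite -(subrr u); apply: linrelB.
have lf : linear f.
  by move=> a u v; apply: uniq (fP _) _; apply: lg.2.
pose F : {linear V -> W} := HB.pack f (GRing.isLinear.Build R V W _ f lf).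
by exists F.
Qed.

End SubmodulePredicates.

Arguments zerop {R} V.
Arguments fullp {R} V.

(** * Noetherian dimension of intervals of submodules *)

Section Deviation.
Context {R : comNzRingType}.
Implicit Types V W : lmodType R.

(** This is N.dim (P / Q) < r, written in the lattice of submodules of V.
    Chains of submodules of P / Q are chains between Q and P, so the
    recursion builds no iterated quotient modules. *)
Fixpoint dev V (r : nat) (Q P : V -> Prop) : Prop :=
  if r is s.+1 then
    forall Y : nat -> V -> Prop, (forall i, is_submod (Y i)) ->
      (forall i, incl (Y i) (Y i.+1)) -> (forall i, incl Q (Y i)) ->
      (forall i, incl (Y i) P) ->
      exists n, forall k, (n <= k)%N -> dev s (Y k) (Y k.+1)
  else incl P Q.

(** Submodules, quotients and isomorphic copies of P / Q are all related to it
    by such a g.  A chain between Q' and P' is pulled back along g to a chain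
    between Q and P, whose steps are related to those of the first chain in the
    same way. *)
Lemma dev_subquot V W (g : V -> W -> Prop) r (Q P : V -> Prop)
    (Q' P' : W -> Prop) :
  linrel g -> is_submod Q -> is_submod P -> is_submod Q' -> incl Q P ->
  (forall v, P' v -> exists2 u, P u & g u v) ->
  (forall u v, g u v -> Q u -> P' v -> Q' v) ->
  dev r Q P -> dev r Q' P'.
Proof.
move=> lg; elim: r Q P Q' P' => [|r IH] Q P Q' P' hQ hP hQ' sQP lift down /=.
  by move=> PQ v P'v; have [u Pu guv] := lift _ P'v; apply: down guv (PQ _ Pu) _.
move=> dP Y hY incY QY YP.
pose X i u := P u /\ exists2 v, Y i v & g u v.
pose Z i := sump (X i) Q.
have hX i : is_submod (X i).
  split=> [|a u u' [Pu [v Yv guv]] [Pu' [v' Yv' guv']]].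
    by split; [apply: is_submod0 | exists 0; [apply: is_submod0 | apply: lg.1]].
  split; first exact: hP.2.
  by exists (a *: v + v'); [apply: (hY i).2 | apply: lg.2].
have hZ i : is_submod (Z i) by apply: submod_sump.
have [||||n nP] := dP Z; rewrite //.
- move=> i u [q Qq [Pu [v Yv guv]]]; exists q => //; split=> //.
  by exists v => //; apply: incY.
- by move=> i; apply: sumpr.
- move=> i u [q Qq [Pu _]]; apply: (is_submodBr hP) Pu _; exact: sQP.
exists n => k nk; apply: IH (nP k nk) => //.
- move=> u [q Qq [Pu [v Yv guv]]]; exists q => //; split=> //.
  by exists v => //; apply: incY.
- move=> v Yv; have [u Pu guv] := lift _ (YP _ _ Yv).
  by exists u => //; apply: sumpl => //; split=> //; exists v.
move=> u v guv [q Qq [Pu [w Yw guw]]] Yv; apply: (is_submodBr (hY k)) (Yw).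
apply: (QY k); apply: (down q) => //.
  by have := linrelB lg guv guw; rewrite opprB addrC subrK.
apply: YP (k.+1) _ _; apply: is_submodB => //; exact: incY.
Qed.

Lemma linrel_id V : linrel (fun u v : V => u = v).
Proof. by split=> // a u u' v v' -> ->. Qed.

Lemma linrel_mod V (x : R) (S : V -> Prop) :
  is_submod S -> linrel (fun u v => S (x *: v - u)).
Proof.
move=> hS; split=> [|a u u' v v' Suv Suv'].
  by rewrite scaler0 subr0; apply: is_submod0.
have -> : x *: (a *: v + v') - (a *: u + u') =
          a *: (x *: v - u) + (x *: v' - u').
  by rewrite scalerDr scalerBr opprD addrACA !scalerA mulrC.
exact: hS.2.
Qed.

Lemma dev_sub V r (Q P Q' P' : V -> Prop) :
  is_submod Q -> is_submod P -> is_submod Q' -> incl Q P ->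
  incl P' P -> incl Q Q' -> dev r Q P -> dev r Q' P'.
Proof.
move=> hQ hP hQ' QP PP QQ; apply: (dev_subquot (linrel_id V)) => //.
  by move=> v /PP Pv; exists v.
by move=> u _ <- /QQ.
Qed.

(** A step Y_k <= Y_k.+1 of a chain is split at Y_k + (Y_k.+1 :&: T).  By the
    modular law the two halves are steps of the chains cut out in [Q, T] and
    pushed into [T, P]. *)
Lemma dev_ext V r (Q T P : V -> Prop) :
  is_submod Q -> is_submod T -> is_submod P -> incl Q T -> incl T P ->
  dev r Q T -> dev r T P -> dev r Q P.
Proof.
move=> hQ hT hP; elim: r Q T P hQ hT hP => [|r IH] Q T P hQ hT hP QT TP /=.
  by move=> TQ PT u /PT/TQ.
move=> dT dP Y hY incY QY YP.
have hI i : is_submod (meetp (Y i) T) by apply: submod_meetp.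
have hD i : is_submod (sump (Y i) T) by apply: submod_sump.
have [||||n1 n1P] := dT (fun i => meetp (Y i) T); rewrite //.
- by move=> i u [Yu Tu]; split=> //; apply: incY.
- by move=> i u Qu; split; [apply: QY | apply: QT].
- by move=> i u [].
have [||||n2 n2P] := dP (fun i => sump (Y i) T); rewrite //.
- by move=> i u [t Tt Yut]; exists t => //; apply: incY.
- by move=> i; apply: sumpr.
- by move=> i u [t Tt Yut]; apply: (is_submodBr hP) (YP _ _ Yut) (TP _ Tt).
exists (maxn n1 n2) => k; rewrite geq_max => /andP[k1 k2].
apply: (IH _ (sump (Y k) (meetp (Y k.+1) T))) => //.
- exact: submod_sump.
- by apply: sumpl.
- move=> u [t [Yt _] Yut]; apply: (is_submodBr (hY _)) Yt; exact: incY.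
- apply: (dev_subquot (linrel_mod 1 (hY k))) (n1P k k1) => //.
  + by move=> u [Yu Tu]; split=> //; apply: incY.
  + by move=> v [t It Yvt]; exists t => //; rewrite scale1r.
  + by move=> u v; rewrite scale1r => Yvu [Yu _] _; apply: is_submodBr Yu.
- apply: (dev_subquot (linrel_id V)) (n2P k k2) => //.
  + exact: submod_sump.
  + by move=> u [t Tt Yut]; exists t => //; apply: incY.
  + by move=> v Yv; exists v => //; apply: sumpl.
  + move=> u _ <- [t Tt Yut] Yu; exists t => //; split=> //.
    by apply: (is_submodBl (hY _)) Yu; apply: incY.
Qed.

Lemma devS V r (Q P : V -> Prop) :
  is_submod Q -> is_submod P -> incl Q P -> dev r Q P -> dev r.+1 Q P.
Proof.
move=> hQ hP QP dQP Y hY incY QY YP; exists 0%N => k _.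
exact: (dev_sub (Q := Q) (P := P)).
Qed.

(** The graph of the projection from P to P / Q, seen in V. *)
Definition subquot_rel V (P Q : submodClosed V) (u : V) (w : subquot P Q) :
  Prop := exists2 p : submod P, val p = u & quotmod_pi _ p = w.

Lemma subquot_rel_linrel V (P Q : submodClosed V) :
  linrel (@subquot_rel V P Q).
Proof.
split=> [|a u u' v v' [p <- <-] [p' <- <-]].
  by exists 0; rewrite ?linear0.
by exists (a *: p + p'); rewrite ?linearP.
Qed.

Lemma subquot_rel_ex V (P Q : submodClosed V) u :
  u \in P -> exists w, @subquot_rel V P Q u w.
Proof. by move=> Pu; exists (quotmod_pi _ (Submod Pu)), (Submod Pu). Qed.

Lemma subquot_rel_surj V (P Q : submodClosed V) w :
  exists u, @subquot_rel V P Q u w.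
Proof. by exists (val (repr w)), (repr w) => //; exact: reprK. Qed.

Lemma subquot_rel_dom V (P Q : submodClosed V) u w :
  @subquot_rel V P Q u w -> u \in P.
Proof. by move=> [p <- _]; apply: valP. Qed.

Lemma subquot_rel0 V (P Q : submodClosed V) u w :
  @subquot_rel V P Q u w -> w = 0 <-> u \in Q.
Proof.
move=> [p <- <-]; rewrite -(linear0 (quotmod_pi _)); split=> [/quotmodP|Qp].
  by rewrite subr0 inE.
by apply/quotmodP; rewrite subr0 inE.
Qed.

Lemma dev_subquotE V (P Q : submodClosed V) r : {subset Q <= P} ->
  dev r (zerop (subquot P Q)) (fullp _) <->
  dev r (fun u => u \in Q) (fun u => u \in P).
Proof.
move=> QP; have lg := subquot_rel_linrel P Q; split.
  apply: (dev_subquot (g := fun w u => @subquot_rel V P Q u w)) => //.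
  - by split=> [|a u u' v v']; [apply: lg.1 | apply: lg.2].
  - exact: submod_zerop.
  - exact: submod_mem.
  - by move=> u /(@subquot_rel_ex _ _ Q)[w]; exists w.
  - by move=> w u /subquot_rel0 [+ _] w0 _; apply.
apply: (dev_subquot lg) => //; try exact: submod_mem.
- exact: submod_zerop.
- move=> w _; have [u uw] := subquot_rel_surj w.
  by exists u => //; apply: subquot_rel_dom uw.
- by move=> u w /subquot_rel0[_ +] Qu _; apply.
Qed.

(** The disjunction in the definition of [Ndim_lt] collapses since
    [dev] is monotone in r. *)
Lemma Ndim_ltE V r : Ndim_lt r V <-> dev r (zerop V) (fullp V).
Proof.
elim: r V => [|r IH] V; first by split=> V0 u; [move=> _ |]; apply: V0.
split=> [[/IH|[_ cV]] | dV].
- by apply: devS => //; apply: submod_zerop.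
- move=> Y hY incY _ _; pose Y' i : submodClosed V := asbool_submod (hY i).
  have sY i : {subset Y' i <= Y' i.+1}.
    by move=> u /asbool_submodE Yu; apply/asbool_submodE/incY.
  have [n nP] := cV Y' sY; exists n => k nk.
  have /IH/(dev_subquotE r (sY k)) := nP k nk.
  apply: dev_sub; try exact: submod_mem; try exact: hY.
  + exact: sY.
  + by move=> u Yu; apply/asbool_submodE.
  + by move=> u /asbool_submodE.
have [NV|NV] := pselect (Ndim_lt r V); [by left | right; split=> //].
move=> Y sY; have [||||n nP] := dV (fun i u => u \in Y i).
- by move=> i; apply: submod_mem.
- by move=> i u; apply: sY.
- by move=> i u ->; apply: rpred0.
- by [].
by exists n => k nk; apply/IH/dev_subquotE => //; apply: nP.
Qed.

Lemma is_NdimE V r : is_Ndim V r <->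
  ~ dev r (zerop V) (fullp V) /\ dev r.+1 (zerop V) (fullp V).
Proof.
rewrite -!Ndim_ltE; split=> [[nV cV]|[nV [//|[_ cV]]]] //.
by split=> //; right; split.
Qed.

End Deviation.

(** * Chain conditions and dimension of modules with x-torsion *)

Section ChainConditions.
Context {R : comNzRingType} {V : lmodType R}.
Implicit Types Q P Y : V -> Prop.

Definition dcc Q P : Prop :=
  forall Y : nat -> V -> Prop, (forall i, is_submod (Y i)) ->
    (forall i, incl (Y i.+1) (Y i)) -> (forall i, incl Q (Y i)) ->
    (forall i, incl (Y i) P) ->
    exists n, forall k, (n <= k)%N -> incl (Y n) (Y k).

Lemma dcc_sub Q P Q' P' : incl Q Q' -> incl P' P -> dcc Q P -> dcc Q' P'.
Proof.
move=> QQ PP dP Y hY decY QY YP; apply: dP => // i u; first by move/QQ/QY.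
by move/YP/PP.
Qed.

Lemma incl_dec (Y : nat -> V -> Prop) : (forall i, incl (Y i.+1) (Y i)) ->
  forall i j, (i <= j)%N -> incl (Y j) (Y i).
Proof.
move=> decY i j /subnK<-; elim: (j - i)%N => [|k IH] u //=.
by rewrite addSn => /decY/IH.
Qed.

Variable x : R.

Definition killed k Q P : V -> Prop := meetp P (scale_preim (x ^+ k) Q).

Definition power_torsion Q P : Prop :=
  forall u, P u -> exists k, Q (x ^+ k *: u).

(** Let F_k be the submodule of Y of the elements that x ^+ k sends into Q.
    Multiplication by x ^+ k embeds F_k.+1 / F_k into the elements killed by x
    modulo Q, and [lead k Q Y] is the image. *)
Definition lead k Q Y : V -> Prop :=
  fun u => exists y, [/\ Y y, Q (x ^+ k.+1 *: y) & Q (u - x ^+ k *: y)].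

Lemma submod_killed k Q P : is_submod Q -> is_submod P ->
  is_submod (killed k Q P).
Proof. by move=> hQ hP; apply: submod_meetp => //; apply: submod_scale_preim. Qed.

Lemma submod_lead k Q Y : is_submod Q -> is_submod Y -> is_submod (lead k Q Y).
Proof.
move=> hQ hY; split=> [|a u v [y [Yy Qy Quy]] [z [Yz Qz Qvz]]].
  by exists 0; rewrite !scaler0 subr0; split; apply: is_submod0.
exists (a *: y + z); split; first exact: hY.2.
  by rewrite scalerDr scalerA mulrC -scalerA; apply: hQ.2.
rewrite scalerDr opprD addrACA scalerA [_ * a]mulrC -scalerA -scalerBr.
exact: hQ.2.
Qed.

Lemma lead_sub k Q Y : is_submod Y -> is_submod Q -> incl Q (lead k Q Y).
Proof.
move=> hY hQ u Qu; exists 0; rewrite !scaler0 subr0.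
by split=> //; apply: is_submod0.
Qed.

Lemma lead_incl k Q Y Y' : incl Y Y' -> incl (lead k Q Y) (lead k Q Y').
Proof. by move=> YY u [y [/YY Yy Qy Quy]]; exists y. Qed.

Lemma lead_dec Q Y : is_submod Y ->
  forall j k, (j <= k)%N -> incl (lead k Q Y) (lead j Q Y).
Proof.
move=> hY; apply: incl_dec => k u [y [Yy Qy Quy]].
exists (x *: y); rewrite !scalerA -!exprSr; split=> //.
exact: is_submodZ.
Qed.

Lemma lead_killed k Q P Y : is_submod Q -> is_submod P -> incl Q P ->
  incl Y P -> incl (lead k Q Y) (killed 1 Q P).
Proof.
move=> hQ hP QP YP u [y [Yy Qy Quy]]; split.
  by apply: (is_submodBr hP) (QP _ Quy) _; apply: is_submodZ => //; apply: YP.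
rewrite /scale_preim expr1.
have := is_submodZ hQ x Quy; rewrite scalerBr scalerA -exprS.
by move/(is_submodBr hQ); apply.
Qed.

(** A torsion submodule is determined by its pieces: subtract from u an element
    of Y with the same leading piece, which lowers the power of x that sends u
    into Q. *)
Lemma lead_inj Q Y Y' : is_submod Q -> is_submod Y -> is_submod Y' ->
  incl Q Y -> incl Y Y' -> power_torsion Q Y' ->
  (forall k, incl (lead k Q Y') (lead k Q Y)) -> incl Y' Y.
Proof.
move=> hQ hY hY' QY YY' tors leadP u Y'u; have [k] := tors u Y'u.
elim: k u Y'u => [|k IH] u Y'u; first by rewrite scale1r => /QY.
move=> Qu; have [|y [Yy Qy Quy]] := leadP k (x ^+ k *: u).
  by exists u; split=> //; rewrite subrr; apply: is_submod0.
apply: (is_submodBr hY) (Yy); apply: IH; rewrite ?scalerBr //.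
exact: is_submodB (YY' _ Yy).
Qed.

(** The pieces [lead k Q (Y n)] decrease in both k and n.  Along the diagonal
    they stabilize at some N, which settles all k >= N at once; the finitely
    many k < N are settled one by one. *)
Lemma dcc_torsion Q P : is_submod Q -> is_submod P -> incl Q P ->
  power_torsion Q P -> dcc Q (killed 1 Q P) -> dcc Q P.
Proof.
move=> hQ hP QP tors dK Y hY decY QY YP.
have decY' := incl_dec decY.
have leadK k n : incl (lead k Q (Y n)) (killed 1 Q P) by apply: lead_killed.
have [||||N NP] := dK (fun n => lead n Q (Y n)); rewrite //.
- by move=> n; apply: submod_lead.
- by move=> n u /(lead_dec (hY n.+1) (leqnSn n))/lead_incl; apply.
- by move=> n; apply: lead_sub.
have /choice[c cP] : forall k, exists c, forall n, (c <= n)%N ->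
    incl (lead k Q (Y c)) (lead k Q (Y n)).
  move=> k; apply: dK => // n; [exact: submod_lead | | exact: lead_sub].
  by apply: lead_incl.
pose M := maxn N (\max_(k < N) c k); exists M => n Mn.
apply: (lead_inj hQ) => //; first exact: decY'.
  by move=> u /YP/tors.
move=> k u Lu; have [Nk|kN] := leqP N k.
  have /NP : (N <= maxn n k)%N by rewrite leq_max Nk orbT.
  move=> /(_ u) LN; have {LN}: lead (maxn n k) Q (Y (maxn n k)) u.
    apply: LN; apply: (lead_dec (hY _) Nk); apply: lead_incl Lu.
    by apply: decY'; rewrite leq_maxl.
  move=> /(lead_dec (hY _) (leq_maxr n k)); apply: lead_incl.
  by apply: decY'; rewrite leq_maxl.
have ckM : (c k <= M)%N.
  by rewrite leq_max (leq_bigmax (Ordinal kN)) orbT.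
apply: (cP k n (leq_trans ckM Mn)); apply: lead_incl Lu; exact: decY'.
Qed.

Lemma killed_leq k l Q P : is_submod Q -> (k <= l)%N ->
  incl (killed k Q P) (killed l Q P).
Proof.
move=> hQ kl u [Pu Qu]; split=> //.
rewrite /scale_preim -(subnK kl) exprD -scalerA.
exact: is_submodZ.
Qed.

Lemma killed_dev r Q P k : is_submod Q -> is_submod P -> incl Q P ->
  dev r Q (killed 1 Q P) -> dev r Q (killed k Q P).
Proof.
move=> hQ hP QP d1; have hK j := submod_killed j hQ hP.
have QK j : incl Q (killed j Q P).
  by move=> u Qu; split; [apply: QP | apply: is_submodZ].
elim: k => [|k IH].
  apply: dev_sub d1 => // u [Pu]; rewrite /scale_preim scale1r => Qu.
  by apply: (QK 1%N).
apply: (dev_ext (T := killed k Q P)) IH _ => //; first exact: killed_leq.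
apply: (dev_subquot (linrel_mod (x ^+ k) hQ)) d1 => //.
  move=> v [Pv Qv]; exists (x ^+ k *: v); last first.
    by rewrite subrr; apply: is_submod0.
  split; first exact: is_submodZ.
  by rewrite /scale_preim expr1 scalerA -exprS.
by move=> u v Qvu Qu [Pv _]; split=> //; apply: is_submodBr Qu.
Qed.

(** For consecutive terms Y <= Y' of a chain, choose K such that the pieces of
    both are constant from K on.  Then Y' / Y is an extension of a module L by a
    module killed by x ^+ K.  The latter is filtered by subquotients of the
    elements killed by x, and the elements of L killed by x are the quotient
    of the limit pieces of Y' and Y.  The limit pieces form a chain in the
    elements killed by x, so that quotient has smaller dimension far along the
    chain, and induction applies to L. *)
Lemma dev_torsion r Q P : is_submod Q -> is_submod P -> incl Q P ->
  dcc Q P -> power_torsion Q P -> dev r Q (killed 1 Q P) -> dev r.+1 Q P.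
Proof.
elim: r Q P => [|r IH] Q P hQ hP QP dP tors d1.
  apply: devS => // u Pu; have [k] := tors u Pu.
  elim: k => [|k IHk]; first by rewrite scale1r.
  rewrite exprS -scalerA => Qu; apply: IHk; apply: d1; split.
    exact: is_submodZ.
  by rewrite /scale_preim expr1.
move=> Y hY incY QY YP.
have hK j := submod_killed j hQ hP.
pose G i k := lead k Q (Y i); pose Goo i u := forall k, G i k u.
have hG i k : is_submod (G i k) by apply: submod_lead.
have hGoo i : is_submod (Goo i).
  split=> [k|a u v Gu Gv k]; [exact: is_submod0 | exact: (hG i k).2].
have [||||n nP] := d1 Goo; rewrite //.
- by move=> i u Gu k; apply: lead_incl (Gu k).
- by move=> i u Qu k; apply: lead_sub.
- by move=> i u /(_ 0%N); apply: lead_killed.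
exists n => i ni; have dG := nP i ni.
have stab j : exists K, forall k, (K <= k)%N -> incl (G j K) (G j k).
  apply: dP => // k; first by move=> u; apply: lead_dec.
    exact: lead_sub.
  by move=> u Gu; have [] := lead_killed hQ hP QP (YP j) Gu.
have [K0 K0P] := stab i; have [K1 K1P] := stab i.+1.
pose K := maxn K0 K1.
have GK j K' : (forall k, (K' <= k)%N -> incl (G j K') (G j k)) ->
    (K' <= K)%N -> incl (G j K) (Goo j).
  move=> stK K'K u Gu k; have := stK (maxn K' k) (leq_maxl _ _) u.
  move=> /(_ (lead_dec (hY j) K'K Gu)); apply: lead_dec (leq_maxr _ _) _ => //.
have G0 := GK i K0 K0P (leq_maxl _ _).
have G1 := GK i.+1 K1 K1P (leq_maxr _ _).
pose L k := sump (Y i) (killed k Q (Y i.+1)).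
have hL k : is_submod (L k) by apply: submod_sump => //; apply: submod_killed.
have YL k : incl (Y i) (L k) by apply: sumpl; apply: submod_killed.
have LY k : incl (L k) (Y i.+1).
  move=> u [t [Yt _] Yut]; apply: (is_submodBr (hY _)) Yt; exact: incY.
have Lleq k l : (k <= l)%N -> incl (L k) (L l).
  by move=> kl u [t Kt Yut]; exists t => //; apply: killed_leq kl _ Kt.
apply: (dev_ext (T := L K)) => //.
  apply: (dev_subquot (linrel_mod 1 (hY i))) (killed_dev K hQ hP QP d1) => //.
  - by move=> u Qu; split; [apply: QP | apply: is_submodZ].
  - move=> v [t [Yt Qt] Yvt]; exists t; last by rewrite scale1r.
    by split=> //; apply: YP Yt.
  - by move=> u v; rewrite scale1r => Yvu /(QY i) Yu _; apply: is_submodBr Yu.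
apply: IH => //.
- apply: dcc_sub dP; last exact: YP.
  by move=> u /QY/YL; apply.
- by move=> u /YP/tors[k Qu]; exists k; apply/YL/QY.
(* For u in L N.+2 with x u in L K and N >= K, the leading term of u is
   x ^+ N y with y in Y.  It lies in the piece of Y at level N, hence in the
   one at level N.+1, and so it can be cancelled by an element of Y. *)
have red N u : (K < N)%N -> Y i.+1 u -> L K (x *: u) -> L N.+1 u -> L N u.
  case: N => // N KN Yu [a [Ya Qa] Yxua] [a1 [Ya1 Qa1] Yua1].
  pose y := x *: a1 - a.
  have Yy : Y i y.
    have -> : y = (x *: u - a) - x *: (u - a1).
      by rewrite scalerBr opprB addrC addrA subrK.
    exact: is_submodB Yxua (is_submodZ _ _ Yua1).
  have Qa' : Q (x ^+ N *: a).
    by rewrite -(subnK (KN : (K <= N)%N)) exprD -scalerA; apply: is_submodZ.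
  have Gy : G i N (x ^+ N *: y).
    exists y; rewrite subrr; split=> //; last exact: is_submod0.
    rewrite /y scalerBr scalerA -exprSr.
    apply: (is_submodB hQ) => //.
    by rewrite exprS -scalerA; apply: is_submodZ.
  have [y' [Yy' Qy' Qyy']] : G i N.+1 (x ^+ N *: y).
    by apply: G0; apply: (lead_dec (hY i) (KN : (K <= N)%N)).
  exists (a1 - y').
    split; first exact: is_submodB (incY _ _ Yy').
    rewrite /scale_preim scalerBr; move: Qyy'.
    rewrite /y scalerBr scalerA -exprSr => Qyy'.
    apply: (is_submodBr hQ) Qa'; by rewrite addrAC.
  by rewrite opprB addrA addrAC; apply: is_submodD.
have LK1 u : Y i.+1 u -> L K (x *: u) -> L K.+1 u.
  move=> Yu Lxu; have [N Qu] := tors u (YP _ _ Yu).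
  have LN : L (K.+1 + N)%N u.
    apply: (sumpr (hY i)); split=> //; rewrite /scale_preim exprD -scalerA.
    exact: is_submodZ.
  elim: N LN {Qu} => [|N IHN]; first by rewrite addn0.
  by rewrite addnS => /red -/(_ _ Yu Lxu) LN; apply/IHN/LN; rewrite leq_addr.
(* An element of L K.+1, congruent modulo Y i to some a that x ^+ K.+1 sends
   into Q, corresponds to the leading term x ^+ K a. *)
pose g (u v : V) := exists2 a, killed K.+1 Q (Y i.+1) a & 
  Y i (v - a) /\ u = x ^+ K *: a.
have hK1 := submod_killed K.+1 hQ (hY i.+1).
have lg : linrel g.
  split=> [|c u u' v v' [a Ka [Yva ->]] [a' Ka' [Yva' ->]]].
    exists 0; first exact: is_submod0 hK1.
    by rewrite subr0 scaler0; split=> //; apply: is_submod0.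
  exists (c *: a + a'); first exact: hK1.2.
  split; last by rewrite scalerDr !scalerA mulrC.
  by rewrite opprD addrACA -scalerBr; apply: (hY i).2.
apply: (dev_subquot lg) dG => //.
- by move=> u Gu k; apply: lead_incl (Gu k).
- move=> v [Yv]; rewrite /scale_preim expr1 => /(LK1 _ Yv)[a Ka Yva].
  exists (x ^+ K *: a); last by exists a.
  apply: G1; exists a; rewrite subrr; case: Ka => Ya Qa.
  by split=> //; apply: is_submod0.
- move=> u v [a [Ya Qa] [Yva ->]] /(_ K)[y' [Yy' Qy' Qay']] _.
  exists (a - y').
    split; first exact: is_submodB (incY _ _ Yy').
    by rewrite /scale_preim scalerBr.
  by rewrite opprB addrA addrAC; apply: is_submodD.
Qed.

(** Divisibility by x makes all the steps of the chain 0 :_X x ^+ k isomorphic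
    to the first one, so the first one is as small as a late one. *)
Lemma dev_divisible r Q P : is_submod Q -> is_submod P -> incl Q P ->
  (forall u, P u -> exists2 v, P v & Q (u - x *: v)) ->
  dev r.+1 Q P -> dev r Q (killed 1 Q P).
Proof.
move=> hQ hP QP divx dP; have hK j := submod_killed j hQ hP.
have divxk k u : P u -> exists2 v, P v & Q (u - x ^+ k *: v).
  elim: k u => [|k IH] u Pu.
    by exists u; rewrite // scale1r subrr; apply: is_submod0.
  have [v Pv Qv] := IH u Pu; have [w Pw Qw] := divx v Pv; exists w => //.
  rewrite exprSr -scalerA -[u](subrK (x ^+ k *: v)) -addrA -scalerBr.
  by apply: is_submodD => //; apply: is_submodZ.
have [|||| n nP] := dP (fun k => killed k Q P); rewrite //.
- by move=> i; apply: killed_leq.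
- by move=> i u Qu; split; [apply: QP | apply: is_submodZ].
- by move=> i u [].
have := nP n (leqnn n); pose g u v := Q (x ^+ n *: u - v).
apply: (dev_subquot (g := g)) => //.
- split=> [|a u u' v v' gu gu']; first by apply: (linrel_mod (x ^+ n) hQ).1.
  exact: (linrel_mod (x ^+ n) hQ).2.
- exact: killed_leq.
- move=> v [Pv Qv]; have [u Pu Qvu] := divxk n v Pv; exists u.
    split=> //; rewrite /scale_preim exprS -scalerA.
    by apply: (is_submodBl hQ) Qv; rewrite expr1 -scalerBr; apply: is_submodZ.
  exact: is_submodBC.
- by move=> u v gu [_ Qu] _; apply: is_submodBl gu Qu.
Qed.

End ChainConditions.

(** * Noetherian modules, powers of the maximal ideal, prime ideals *)

Section Noetherian.
Context {R : comNzRingType}.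
Implicit Types V : lmodType R.

Definition noetherian V : Prop := dev 1 (zerop V) (fullp V).

Lemma incl_inc V (Y : nat -> V -> Prop) : (forall i, incl (Y i) (Y i.+1)) ->
  forall i j, (i <= j)%N -> incl (Y i) (Y j).
Proof.
move=> incY i j /subnK<-; elim: (j - i)%N => [|k IH] u //=.
by rewrite addSn => /IH/incY.
Qed.

Lemma noetherian_max V (F : (V -> Prop) -> Prop) : noetherian V ->
  (exists2 S, is_submod S & F S) ->
  exists S, [/\ is_submod S, F S &
    forall T, is_submod T -> F T -> incl S T -> incl T S].
Proof.
move=> nV [S0 hS0 FS0]; apply: contrapT => noMax.
pose D := {S : V -> Prop | is_submod S /\ F S}.
have /choice[f fP] (S : D) :
    exists T : D, incl (sval S) (sval T) /\ ~ incl (sval T) (sval S).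
  case: S => S [hS FS] /=; apply: contrapT => noT; apply: noMax.
  exists S; split=> // T hT FT ST; apply: contrapT => TS; apply: noT.
  by exists (exist _ T (conj hT FT)).
pose Y n := iter n f (exist _ S0 (conj hS0 FS0)).
have [||||n nP] := nV (fun n => sval (Y n)); rewrite //.
- by move=> i; case: (svalP (Y i)).
- by move=> i; case: (fP (Y i)).
- by move=> i u ->; apply: is_submod0; case: (svalP (Y i)).
by case: (fP (Y n)) => _; apply; apply: nP.
Qed.

Fixpoint spanned V (es : seq V) : V -> Prop :=
  if es is e :: es' then fun u => exists a, spanned es' (u - a *: e)
  else zerop V.

Lemma submod_spanned V (es : seq V) : is_submod (spanned es).
Proof.
elim: es => [|e es IH] /=; first exact: submod_zerop.
split=> [|a u v [b Su] [c Sv]].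
  by exists 0; rewrite scale0r subr0; apply: is_submod0.
exists (a * b + c); rewrite scalerDl opprD addrACA -scalerA -scalerBr.
exact: IH.2.
Qed.

Lemma finitely_generated_spanned V :
  finitely_generated V -> exists es : seq V, forall u, spanned es u.
Proof.
move=> [n [e eP]]; exists [seq e i | i <- index_enum 'I_n] => u.
have [c ->] := eP u; elim: (index_enum _) => [|i r IH] /=.
  by rewrite big_nil.
by exists (c i); rewrite big_cons addrAC subrr add0r.
Qed.

Lemma noetherian_regular : noetherian_ring R -> noetherian R^o.
Proof.
move=> nR Y hY incY _ _; have incY' := incl_inc incY.
pose U (u : R^o) := exists i, Y i u.
have hU : is_submod U.
  split=> [|a u v [i Yu] [j Yv]]; first by exists 0%N; apply: is_submod0.
  exists (maxn i j); apply: (hY _).2; first by apply: incY' Yu; rewrite leq_maxl.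
  by apply: incY' Yv; rewrite leq_maxr.
have [n [e eP]] := nR (asbool_submod hU).
have /choice[c cP] i : exists c, Y c (val (e i)).
  by have /asbool_submodE := valP (e i).
pose N := (\max_i c i)%N.
have UN : incl U (Y N).
  move=> u Uu; have Uu' : u \in asbool_submod hU by apply/asbool_submodE.
  have [a uE] := eP (Submod Uu'); have -> : u = val (Submod Uu') by [].
  rewrite uE raddf_sum; elim/big_ind: _ => //.
  - exact: is_submod0.
  - by move=> v w; apply: is_submodD.
  move=> i _; apply: (is_submodZ (hY N) (a i) (u := val (e i))).
  by apply: incY' (cP i); apply: leq_bigmax.
exists N => k Nk u Yu; apply: incY' Nk _ _; apply: UN; by exists k.+1.
Qed.

(** Adding a generator e adds a quotient of R, through a |-> a e. *)
Lemma noetherian_fg V : noetherian R^o -> finitely_generated V -> noetherian V.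
Proof.
move=> nR /finitely_generated_spanned[es esP].
have z0 es' : incl (zerop V) (spanned es').
  by move=> u ->; apply: is_submod0; apply: submod_spanned.
suff: dev 1 (zerop V) (spanned es).
  by move=> ds; apply: dev_sub ds => //; exact: submod_zerop.
elim: es {esP} => [|e es IH].
  by apply: devS => //; apply: submod_zerop.
have [hs hes] := (submod_spanned es, submod_spanned (e :: es)).
have ses : incl (spanned es) (spanned (e :: es)).
  by move=> u su; exists 0; rewrite scale0r subr0.
apply: (dev_ext (T := spanned es)) => //; first exact: submod_zerop.
pose g (a : R^o) (v : V) := spanned es (v - (a : R) *: e).
apply: (dev_subquot (g := g)) nR => //.
- split=> [|a b b' v v' gv gv'].
    by rewrite /g scale0r subr0; apply: is_submod0.
  rewrite /g scalerDl opprD addrACA -[(a *: b : R^o)]/(a * b) -scalerA -scalerBr.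
  exact: hs.2.
- exact: submod_zerop.
- by move=> v [a]; exists a.
- by move=> a v gv a0 _; move: gv; rewrite /g a0 scale0r subr0.
Qed.

End Noetherian.

Section MaximalPowers.
Context {R : comNzRingType} (m : idealr R).
Implicit Types V W : lmodType R.

(** [kills k S u] says that [m ^ k] sends [u] into [S]. *)
Fixpoint kills V (k : nat) (S : V -> Prop) : V -> Prop :=
  if k is k'.+1 then fun u => forall y, y \in m -> kills k' S (y *: u) else S.

Lemma submod_kills V k (S : V -> Prop) : is_submod S -> is_submod (kills k S).
Proof.
move=> hS; elim: k => [|k IH] //=; split=> [y _|a u v Su Sv y my].
  by rewrite scaler0; apply: is_submod0.
rewrite scalerDr scalerA mulrC -scalerA; apply: IH.2; [exact: Su | exact: Sv].
Qed.

Lemma kills_incl V k (S T : V -> Prop) :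
  incl S T -> incl (kills k S) (kills k T).
Proof.
move=> ST; elim: k => [|k IH] u /=; first exact: ST.
by move=> Su y my; apply/IH/Su.
Qed.

Lemma kills_leq V k l (S : V -> Prop) : is_submod S -> (k <= l)%N ->
  incl (kills k S) (kills l S).
Proof.
move=> hS /subnK<-; elim: (l - k)%N => [|j IH] u //= Su y _.
by apply: IH; apply: is_submodZ => //; apply: submod_kills.
Qed.

Lemma killsD V k l (S : V -> Prop) u :
  kills k (kills l S) u -> kills (k + l) S u.
Proof. by elim: k u => [|k IH] u //= Su y my; apply/IH/Su. Qed.

Lemma kills_rel V W (g : V -> W -> Prop) k (S : V -> Prop) (T : W -> Prop) u v :
  linrel g -> (forall u v, g u v -> S u -> T v) ->
  g u v -> kills k S u -> kills k T v.
Proof.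
move=> lg ST; elim: k u v => [|k IH] u v guv /=; first exact: ST.
by move=> Su y my; apply: IH (Su y my); apply: linrelZ.
Qed.

Lemma kills_map V W (f : {linear V -> W}) k (S : V -> Prop) (T : W -> Prop) u :
  (forall u, S u -> T (f u)) -> kills k S u -> kills k T (f u).
Proof. by move=> ST; apply: kills_rel (linrel_map f) _ _ => // a b -> /ST. Qed.

Lemma kills_expr V k (S : V -> Prop) x u : x \in m ->
  kills k S u -> S (x ^+ k *: u).
Proof.
move=> mx; elim: k u => [|k IH] u /=; first by rewrite scale1r.
by move=> /(_ x mx)/IH; rewrite scalerA -exprSr.
Qed.

Lemma kills_prodP V k (S : V -> Prop) u :
  kills k S u <-> forall a : 'I_k -> R,
    (forall i, a i \in m) -> S (\prod_(i < k) a i *: u).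
Proof.
elim: k u => [|k IH] u /=.
  split=> [Su a _|/(_ (fun=> 0))]; first by rewrite big_ord0 scale1r.
  by rewrite big_ord0 scale1r; apply; case.
split=> [Su a am|Su y my].
  rewrite big_ord_recl mulrC -scalerA.
  exact: (IH _).1 (Su _ (am ord0)) _ (fun i => am (lift ord0 i)).
apply/IH => a am; rewrite scalerA mulrC.
pose b (i : 'I_k.+1) := if unlift ord0 i is Some j then a j else y.
have b0 : b ord0 = y by rewrite /b unlift_none.
have bl i : b (lift ord0 i) = a i by rewrite /b liftK.
have := Su b; rewrite big_ord_recl b0; under eq_bigr do rewrite bl.
by apply=> i; case: (unliftP ord0 i) => [j|] ->; rewrite ?b0 ?bl.
Qed.

Lemma torsionP V (v : V) :
  v \in torsion m V <-> exists k, kills k (zerop V) v.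
Proof.
rewrite inE; split=> [/asboolP|] [k kv]; last apply/asboolP.
  by exists k; apply/kills_prodP.
by exists k; apply/(kills_prodP k (zerop V)).
Qed.

End MaximalPowers.

Section Ideals.
Context {R : comNzRingType}.
Hypothesis nR : noetherian R^o.
Implicit Types J : R^o -> Prop.

Let idealD J a u v : is_submod J -> J u -> J v -> J (a * u + v).
Proof. by move=> hJ; apply: (hJ.2 (a : R)). Qed.

Let idealM J a u : is_submod J -> J u -> J (a * u).
Proof. by move=> hJ; apply: (is_submodZ hJ (a : R)). Qed.

Let add1 J (y : R) : R^o -> Prop := fun b => exists r, J (b - r * y).

Let submod_add1 J y : is_submod J -> is_submod (add1 J y).
Proof.
move=> hJ; split=> [|a u v [r Ju] [s Jv]].
  by exists 0; rewrite mul0r subr0; apply: is_submod0.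
exists (a * r + s); rewrite mulrDl opprD addrACA -mulrA.
rewrite -[a *: u]/(a * u) -mulrBr; exact: idealD.
Qed.

Let add1l J y : incl J (add1 J y).
Proof. by move=> u Ju; exists 0; rewrite mul0r subr0. Qed.

Let add1r J y : is_submod J -> add1 J y y.
Proof. by move=> hJ; exists 1; rewrite mul1r subrr; apply: is_submod0. Qed.

Let ideal_closed J : is_submod J -> ~ J 1 ->
  idealr_closed [pred a : R | `[< J a >]].
Proof.
move=> hJ J1; split=> [||a u v].
- by rewrite inE; apply/asboolP; apply: (is_submod0 hJ).
- by rewrite inE; apply/asboolP.
- rewrite !inE => /asboolP Ju /asboolP Jv.
  by apply/asboolP; apply: idealD hJ Ju Jv.
Qed.

Lemma idealr_of J : is_submod J -> ~ J 1 ->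
  exists I : idealr R, forall a, a \in I <-> J a.
Proof.
move=> hJ J1; pose S : R -> bool := [pred a : R | `[< J a >]].
pose I : idealr R := HB.pack S (isIdealr.Build R S (ideal_closed hJ J1)).
by exists I => a; rewrite inE; split=> /asboolP.
Qed.

Lemma prime_idealr_of J : is_submod J -> ~ J 1 ->
  (forall a b, J (a * b) -> J a \/ J b) ->
  exists p : prime_idealr R, forall a, a \in p <-> J a.
Proof.
move=> hJ J1 Jp; pose S : R -> bool := [pred a : R | `[< J a >]].
have Sp : prime_idealr_closed S.
  move=> a b; rewrite !inE => /asboolP/Jp[] Jx; apply/orP.
    by left; apply/asboolP.
  by right; apply/asboolP.
pose I : prime_idealr R := HB.pack S
  (isIdealr.Build R S (ideal_closed hJ J1)) (isPrimeIdealrClosed.Build R S Sp).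
by exists I => a; rewrite inE; split=> /asboolP.
Qed.

Lemma submod_idealr (I : idealr R) : is_submod (fun a : R^o => (a : R) \in I).
Proof.
split=> [|a u v Iu Iv]; first exact: idealr0.
by apply: rpredD => //; apply: idealMr.
Qed.

(** An ideal maximal among those avoiding a multiplicative set is prime. *)
Lemma prime_avoiding J (T : R -> Prop) : is_submod J -> T 1 ->
  (forall a b, T a -> T b -> T (a * b)) -> (forall a, J a -> ~ T a) ->
  exists p : prime_idealr R,
    (forall a, J a -> a \in p) /\ (forall a, a \in p -> ~ T a).
Proof.
move=> hJ T1 TM JT.
have [|K [hK [JK KT] Kmax]] := noetherian_max
  (F := fun K => incl J K /\ forall a, K a -> ~ T a) nR.
  by exists J; [|split].
have KV y : ~ K y -> exists r b, K b /\ T (b + r * y).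
  move=> Ky; apply: contrapT => noT; apply: Ky.
  apply: (Kmax (add1 K y)); [exact: submod_add1 | | exact: add1l | exact: add1r].
  split=> [u Ju|a [r Ka] Ta]; first by apply: add1l; apply: JK.
  by apply: noT; exists r, (a - r * y); rewrite subrK.
have [|a b Kab|p pK] := prime_idealr_of hK; first by move=> /KT.
  have [Ka|/KV[r [a' [Ka' Ta]]]] := pselect (K a); first by left.
  have [Kb|/KV[s [b' [Kb' Tb]]]] := pselect (K b); first by right.
  case: (KT _ _ (TM _ _ Ta Tb)).
  have -> : (a' + r * a) * (b' + s * b) =
      (b' + s * b) * a' + (r * a * b' + r * s * (a * b)).
    by rewrite mulrDl mulrC [r * a * _]mulrDr [r * a * (_ * _)]mulrACA.
  apply: idealD => //; apply: idealD => //; exact: idealM.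
exists p; split=> a; first by move=> /JK /pK.
by move=> /pK/KT.
Qed.

Context {m : idealr R}.

(** Let K be maximal among the ideals containing J but no power of m.  It is
    prime: if a b were in K but a and b were not, then K + R a and K + R b would
    contain powers of m, and so would K since (K + R a) (K + R b) <= K.  Hence
    K contains m, which is absurd. *)
Lemma prime_power J : is_submod J ->
  (forall p : prime_idealr R, (forall a, J a -> a \in p) -> {subset m <= p}) ->
  exists l, kills m l J 1.
Proof.
move=> hJ Jm; apply: contrapT => noL.
have [|K [hK [JK KL] Kmax]] := noetherian_max
  (F := fun K => incl J K /\ forall l, ~ kills m l K 1) nR.
  by exists J; [|split=> // l Kl; apply: noL; exists l].
have KV y : ~ K y -> exists l, kills m l (add1 K y) 1.
  move=> Ky; apply: contrapT => noK; apply: Ky.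
  apply: (Kmax (add1 K y)); [exact: submod_add1 | | exact: add1l | exact: add1r].
  split=> [u Ju|l Kl]; first by apply: add1l; apply: JK.
  by apply: noK; exists l.
have [|a b Kab|p pK] := prime_idealr_of hK; first by move=> /(KL 0%N).
  have [Ka|/KV[k kP]] := pselect (K a); first by left.
  have [Kb|/KV[l lP]] := pselect (K b); first by right.
  case: (KL (k + l)%N); apply: killsD; apply: kills_incl kP => u [r Ku].
  have [f fE] : exists f : {linear R^o -> R^o}, forall v : R, f v = v * u.
    pose g (v : R) : R^o := v * u.
    have lg : linear (g : R^o -> R^o).
      by move=> c v w; rewrite /g mulrDl -mulrA.
    pose F : {linear R^o -> R^o} :=
      HB.pack g (GRing.isLinear.Build R R^o R^o _ g lg).
    by exists F.
  rewrite -[u]mul1r -fE; apply: kills_map lP => v [s Kv].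
  rewrite fE.
  have -> : v * u = u * (v - s * b) + (s * b * (u - r * a) + s * r * (a * b)).
    have E : s * b * (r * a) = s * r * (a * b) by rewrite mulrACA [b * a]mulrC.
    by rewrite !mulrBr E subrK [u * (s * b)]mulrC subrK mulrC.
  apply: idealD => //; apply: idealD => //; exact: idealM.
apply: (KL 1%N) => /= y my; rewrite -[y *: 1]/(y * 1) mulr1.
by apply/pK; apply: Jm my => a /JK/pK.
Qed.

End Ideals.

(** * Regular sequences and finite length *)

Section LocalRing.
Context {R : comNzRingType} {m : idealr R}.
Hypothesis nR : noetherian R^o.
Hypothesis lR : local_ring m.
Implicit Types M V : lmodType R.

Lemma local_ideal_sub (J : R^o -> Prop) : is_submod J -> ~ J 1 ->
  forall a : R, J a -> a \in m.
Proof.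
move=> hJ J1; have [|K [hK [JK K1] Kmax]] := noetherian_max
  (F := fun K => incl J K /\ ~ K 1) nR; first by exists J; [|split].
have [I IK] := idealr_of hK K1.
have maxI : maximal_ideal I.
  move=> I' II' a Ia; apply/IK.
  apply: (Kmax (fun b : R^o => (b : R) \in I')) Ia; first exact: submod_idealr.
    by split=> [u /JK/IK/II'|] //; rewrite idealr1.
  by move=> u /IK/II'.
by move=> a /JK/IK; rewrite (lR.2 I maxI).
Qed.

Lemma local_unit (y : R) : y \notin m -> exists z, z * y = 1.
Proof.
move=> ny; apply: contrapT => noz; move/negP: ny; apply.
apply: (@local_ideal_sub (fun b : R^o => exists z, (b : R) = z * y)).
- split=> [|a u v [r ->] [s ->]]; first by exists 0; rewrite mul0r.
  by exists (a * r + s); rewrite mulrDl -mulrA.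
- by move=> [z zy]; apply: noz; exists z.
- by exists 1; rewrite mul1r.
Qed.

Lemma local_prime : exists p : prime_idealr R, p =i m.
Proof.
have [||a b ab|p pm] := @prime_idealr_of R (fun b : R^o => (b : R) \in m).
- exact: submod_idealr.
- by rewrite idealr1.
- have [am|/local_unit[z za]] := boolP ((a : R) \in m); [by left | right].
  by rewrite -[b]mul1r -za -mulrA; apply: idealMr.
by exists p => a; apply/idP/idP => /pm.
Qed.

Definition ann M (S : M -> Prop) : R^o -> Prop := fun a => forall u, S (a *: u).

Lemma submod_ann M (S : M -> Prop) : is_submod S -> is_submod (ann S).
Proof.
move=> hS; split=> [u|a b c Sb Sc u]; first by rewrite scale0r; apply: is_submod0.
by rewrite scalerDl -scalerA; apply: hS.2.
Qed.

(** The submodule [S + y M]. *)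
Definition adj M (S : M -> Prop) (y : R) : M -> Prop :=
  fun u => exists v, S (u - y *: v).

Lemma submod_adj M (S : M -> Prop) y : is_submod S -> is_submod (adj S y).
Proof.
move=> hS; split=> [|a u v [w Sw] [w' Sw']].
  by exists 0; rewrite scaler0 subr0; apply: is_submod0.
exists (a *: w + w'); rewrite scalerDr opprD addrACA scalerA [y * a]mulrC.
rewrite -scalerA -scalerBr; exact: hS.2.
Qed.

Lemma adjl M (S : M -> Prop) y : incl S (adj S y).
Proof. by move=> u Su; exists 0; rewrite scaler0 subr0. Qed.

(** The regularity condition on [ys] over M / S, in a form that recurses on the
    first element. *)
Fixpoint regular_mod M (S : M -> Prop) (ys : seq R) : Prop :=
  if ys is y :: ys' then
    (forall u, S (y *: u) -> S u) /\ regular_mod (adj S y) ys'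
  else True.

Lemma in_ideal_mul_rcons M (xs : seq R) x (u : M) :
  in_ideal_mul (rcons xs x) u <-> adj (in_ideal_mul xs) x u.
Proof.
split=> [[c ->]|[v [c cE]]].
  exists (c (size xs)), c; rewrite size_rcons big_ord_recr /= nth_rcons ltnn eqxx.
  by rewrite addrK; apply: eq_bigr => i _; rewrite nth_rcons ltn_ord.
exists (fun i => if (i < size xs)%N then c i else v).
rewrite size_rcons big_ord_recr /= nth_rcons !ltnn eqxx.
rewrite -[u](subrK (x *: v)) cE; congr (_ + _).
by apply: eq_bigr => i _; rewrite nth_rcons ltn_ord.
Qed.

Lemma in_ideal_mulE M (xs : seq R) :
  @in_ideal_mul R M xs = foldl (@adj M) (zerop M) xs.
Proof.
elim/last_ind: xs => [|xs x IH]; apply/funext => u; apply/propext.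
  split=> [[c ->]|->]; first by rewrite big_ord0.
  by exists (fun=> 0); rewrite big_ord0.
by rewrite in_ideal_mul_rcons foldl_rcons IH.
Qed.

Lemma regular_seq_mod M (xs : seq R) :
  regular_seq m M xs -> regular_mod (zerop M) xs.
Proof.
move=> [_ reg _].
suff H ys zs : xs = zs ++ ys ->
    regular_mod (foldl (@adj M) (zerop M) zs) ys by apply: (H xs [::]).
elim: ys zs => [|y ys IH] zs //= xsE; split; last first.
  by rewrite -foldl_rcons; apply: IH; rewrite cat_rcons.
have szs : (size zs < size xs)%N by rewrite xsE size_cat /= addnS ltnS leq_addr.
move=> u; have := reg _ szs u; rewrite in_ideal_mulE.
by rewrite xsE take_size_cat // nth_cat ltnn subnn.
Qed.

Lemma foldl_adj_submod M (S : M -> Prop) ys :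
  is_submod S -> is_submod (foldl (@adj M) S ys).
Proof. by elim: ys S => [|y ys IH] S hS //=; apply/IH/submod_adj. Qed.

Definition prime_lt (p q : prime_idealr R) : Prop :=
  {subset p <= q} /\ ~ {subset q <= p}.

(** A regular element lies in no prime minimal over the annihilator: a prime
    avoiding the multiplicative set of the [y ^+ k * s] with s outside p is
    strictly below p. *)
Lemma prime_below M (S : M -> Prop) y (p : prime_idealr R) : is_submod S ->
  (forall u, S (y *: u) -> S u) -> (forall a, ann (adj S y) a -> a \in p) ->
  exists q : prime_idealr R, prime_lt q p /\ forall a, ann S a -> a \in q.
Proof.
move=> hS reg annp; pose T a := exists2 s, s \notin p & exists k, a = y ^+ k * s.
have yp : y \in p.
  by apply: annp => u; exists u; rewrite subrr; apply: is_submod0.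
have [|||a Sa [s sp [k aE]]|q [Sq qT]] := @prime_avoiding _ nR (ann S) T.
- exact: submod_ann.
- by exists 1; [rewrite idealr1 | exists 0%N; rewrite mul1r].
- move=> a b [s sp [k ->]] [t tp [l ->]]; exists (s * t).
    by rewrite prime_idealrM negb_or sp.
  by exists (k + l)%N; rewrite exprD mulrACA.
- move/negP: sp; apply; apply: annp => u; apply: adjl.
  have {Sa}: S (y ^+ k *: (s *: u)) by rewrite scalerA -aE.
  elim: k {aE} => [|k IH]; first by rewrite scale1r.
  by rewrite exprS -scalerA => /reg.
exists q; split=> //; split=> [a qa|pq].
  apply: contrapT => pa; apply: (qT a qa); exists a; first exact/negP.
  by exists 0%N; rewrite mul1r.
apply: (qT y (pq _ yp)); exists 1; first by rewrite idealr1.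
by exists 1%N; rewrite mulr1.
Qed.

Lemma prime_chain_regular M (S : M -> Prop) ys (p : prime_idealr R) :
  is_submod S -> regular_mod S ys ->
  (forall a, ann (foldl (@adj M) S ys) a -> a \in p) ->
  exists f : nat -> prime_idealr R, [/\ f (size ys) = p,
    forall a, ann S a -> a \in f 0%N &
    forall i, (i < size ys)%N -> prime_lt (f i) (f i.+1)].
Proof.
elim: ys S => [|y ys IH] S hS /=; first by move=> _ Sp; exists (fun=> p).
move=> [reg /IH{}IH] /(IH (submod_adj y hS))[f [fp f0 flt]].
have [q [qlt Sq]] := prime_below hS reg f0.
by exists (fun i => if i is j.+1 then f j else q); split=> // -[|i] // /flt.
Qed.

(** A prime p other than m above the annihilator of the last quotient would
    begin a chain p < m, which [prime_chain_regular] prolongs downwards by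
    [size ys] steps: one too many. *)
Lemma prime_over_system M ys (p : prime_idealr R) :
  is_krull_dim M (size ys) -> regular_mod (zerop M) ys ->
  (forall a, ann (foldl (@adj M) (zerop M) ys) a -> a \in p) ->
  {subset m <= p}.
Proof.
move=> [_ dimM] reg annp; apply: contrapT => mp.
have [f [fp f0 flt]] := prime_chain_regular (submod_zerop M) reg annp.
have [pm pmE] := local_prime.
have pm_lt : prime_lt p pm.
  split=> [a pa|pmp]; last by apply: mp => a; rewrite -pmE => /pmp.
  rewrite pmE; apply: (local_ideal_sub (submod_idealr p)) pa.
  by rewrite idealr1.
pose g i := if (i <= size ys)%N then f i else pm.
have glt i : (i <= size ys)%N -> prime_lt (g i) (g i.+1).
  move=> il; rewrite /g il; move: il; rewrite leq_eqVlt => /predU1P[->|il].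
    by rewrite ltnn fp.
  by rewrite il; apply: flt.
have glt' i j : (i < j <= (size ys).+1)%N -> prime_lt (g i) (g j).
  elim: j => // j IHj /andP[]; rewrite ltnS leq_eqVlt.
  move=> /predU1P[-> /glt //|ij jd].
  have [sub1 nsub1] := IHj (introT andP (conj ij (ltnW jd))).
  have [sub2 nsub2] := glt j jd.
  by split=> [a /sub1/sub2|sub] //; apply: nsub2 => a /sub/sub1.
suff /dimM : prime_chain M (size ys).+1 by rewrite ltnn.
exists (fun i => g i); split=> [i a|i j ij].
  move=> annM; have /f0 f0a : ann (zerop M) a by [].
  have g0 : a \in g 0%N by [].
  case: (posnP i) => [->//|i0].
  by apply: (glt' 0%N i _).1; rewrite // i0 -ltnS ltn_ord.
by apply: glt'; rewrite ij -ltnS ltn_ord.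
Qed.

Lemma system_kills M ys : is_krull_dim M (size ys) ->
  regular_mod (zerop M) ys ->
  exists l, forall u, kills m l (foldl (@adj M) (zerop M) ys) u.
Proof.
move=> dimM reg; set S := foldl _ _ _.
have hS : is_submod S by apply/foldl_adj_submod/submod_zerop.
have [|l lP] := @prime_power _ nR m (ann S) (submod_ann hS).
  by move=> p; apply: prime_over_system.
exists l => u; move: lP; rewrite -[u]scale1r; move: (1 : R).
elim: l => [|l IH] a /=; first by move=> /(_ u).
by move=> Sa y my; rewrite scalerA; apply/IH/Sa.
Qed.

(** Among the submodules with the descending chain condition a maximal one is
    everything: otherwise it could be extended by an element that m sends into
    it, which generates a simple quotient. *)
Lemma dcc_kills V l : noetherian V ->
  (forall u : V, kills m l (zerop V) u) -> dcc (zerop V) (fullp V).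
Proof.
move=> nV kV; have [|S [hS dS Smax]] := noetherian_max (F := dcc (zerop V)) nV.
  exists (zerop V); first exact: submod_zerop.
  by move=> Y hY _ zY Yz; exists 0%N => k _ u /Yz/zY.
have full u : S u.
  apply: contrapT => nSu.
  have [v [nSv mv]] : exists v, ~ S v /\ forall y, y \in m -> S (y *: v).
    have := kV u; elim: l u nSu {kV} => [|l IH] u nSu /=.
      by move=> u0; case: nSu; rewrite u0; apply: is_submod0.
    move=> ku; have [mu|/existsNP[y /not_implyP[my nSy]]] :=
      pselect (forall y, y \in m -> S (y *: u)); first by exists u.
    exact: IH nSy (ku y my).
  apply: nSv; pose T w := exists a, S (w - a *: v).
  have hT : is_submod T.
    split=> [|a w w' [b Sb] [c Sc]].
      by exists 0; rewrite scale0r subr0; apply: is_submod0.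
    exists (a * b + c); rewrite scalerDl opprD addrACA -scalerA -scalerBr.
    exact: hS.2.
  have ST : incl S T by move=> w Sw; exists 0; rewrite scale0r subr0.
  apply: (Smax T) => //; last first.
    by exists 1; rewrite scale1r subrr; apply: is_submod0.
  move=> Y hY decY zY YT.
  have [[n YS]|nYS] := pselect (exists n, incl (Y n) S).
    have [||||k kP] := dS (fun i => Y (n + i)%N); rewrite //.
    - by move=> i; rewrite addnS; apply: decY.
    - by move=> i w /(incl_dec decY (leq_addr i n))/YS.
    exists (n + k)%N => j nkj; rewrite -(subnKC (leq_trans (leq_addr k n) nkj)).
    by apply: kP; rewrite -(leq_add2l n) subnKC // (leq_trans (leq_addr k n)).
  have [||||n nP] := dS (fun i => meetp (Y i) S); rewrite //.
  - by move=> i; apply: submod_meetp.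
  - by move=> i w [Yw Sw]; split=> //; apply: decY.
  - by move=> i w ->; split; apply: is_submod0.
  - by move=> i w [].
  exists n => k nk w Yw.
  have [w' [Yw' nSw']] : exists w', Y k w' /\ ~ S w'.
    apply: contrapT => H; apply: nYS; exists k => w' Yw'.
    by apply: contrapT => nS; apply: H; exists w'.
  have [b Sb] := YT k w' Yw'; have [a Sa] := YT n w Yw.
  have [|z zb] := @local_unit b.
    apply/negP => /mv Sbv; apply: nSw'; exact: is_submodBr Sb Sbv.
  have Yk : Y k ((a * z) *: w') by apply: is_submodZ.
  apply: (is_submodBr (hY k)) Yk.
  suff [] : meetp (Y k) S (w - (a * z) *: w') by [].
  apply: (nP k nk); split.
    apply: is_submodB => //; apply: is_submodZ => //; exact: incl_dec Yw'.
  have := is_submodB hS Sa (is_submodZ hS (a * z) Sb).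
  by rewrite scalerBr scalerA -mulrA zb mulr1 opprB subrKA.
by move=> Y hY decY zY _; apply: dS => // i w _; apply: full.
Qed.

End LocalRing.

(** * Towers of kernels *)

Section Tower.
Context {R : comNzRingType} (m : idealr R).
Implicit Types X Y : lmodType R.

(** The shape of the top local cohomology of a Cohen-Macaulay module: the
    elements of [xs] act surjectively, one after the other, on successive
    kernels, and the last kernel is a nonzero module of finite length. *)
Fixpoint tower (xs : seq R) X : Prop :=
  if xs is x :: xs' then
    [/\ x \in m, forall u : X, exists v, x *: v = u,
        power_torsion x (zerop X) (fullp X) &
        exists Y (j : {linear Y -> X}), [/\ tower xs' Y, injective j &
          forall u, x *: u = 0 <-> exists y, j y = u]]
  else [/\ noetherian X, exists l, forall u : X, kills m l (zerop X) u &
           exists u : X, u <> 0].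

Section Kernel.
Variables (x : R) (X Y : lmodType R) (j : {linear Y -> X}).
Hypothesis j_inj : injective j.
Hypothesis j_ker : forall u, x *: u = 0 <-> exists y, j y = u.

Local Notation kerx := (killed x 1 (zerop X) (fullp X)).

Let kerxP u : kerx u <-> exists y, j y = u.
Proof.
split=> [[_ xu]|/j_ker xu].
  by apply/j_ker; move: xu; rewrite /scale_preim expr1.
by split.
Qed.

Lemma dcc_kernel : dcc (zerop Y) (fullp Y) -> dcc (zerop X) kerx.
Proof.
move=> dY Z hZ decZ _ Zker.
have [||||n nP] := dY (fun i y => Z i (j y)); rewrite //.
- move=> i; split=> [|a u v Zu Zv]; first by rewrite linear0; apply: is_submod0.
  by rewrite linearP; apply: (hZ i).2.
- by move=> i y; apply: decZ.
- by move=> i y ->; rewrite linear0; apply: is_submod0.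
exists n => k nk u Zu; have /kerxP[y yu] := Zker n u Zu.
by move: Zu; rewrite -yu; apply: nP.
Qed.

Lemma dev_kernel r : dev r (zerop Y) (fullp Y) <-> dev r (zerop X) kerx.
Proof.
have hker : is_submod kerx.
  by apply: submod_killed; [exact: submod_zerop | exact: submod_fullp].
have lj := linrel_map j.
split.
  apply: (dev_subquot lj) => //; try exact: submod_zerop.
  - by move=> u /kerxP[y <-]; exists y.
  - by move=> y u -> ->; rewrite /zerop linear0.
apply: (dev_subquot (g := fun u y => u = j y)) => //; try exact: submod_zerop.
- by split=> [|a u u' v v']; [apply: lj.1 | apply: lj.2].
- by move=> u ->; split=> //; apply: scaler0.
- by move=> y _; exists (j y) => //; apply/kerxP; exists y.
- by move=> u y -> /eqP + _; rewrite raddf_eq0 // => /eqP.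
Qed.

End Kernel.

Lemma tower_dcc xs X : noetherian R^o -> local_ring m -> tower xs X ->
  dcc (zerop X) (fullp X).
Proof.
move=> nR lR; elim: xs X => [|x xs IH] X /=.
  by move=> [nX [l kX] _]; apply: (dcc_kills nR lR nX kX).
move=> [_ _ tors [Y [j [/IH dY j_inj j_ker]]]].
apply: (@dcc_torsion _ _ x) => //; first exact: submod_zerop.
exact: dcc_kernel dY.
Qed.

Lemma dcc_artinian X : dcc (zerop X) (fullp X) -> artinian X.
Proof.
move=> dX Y decY; have [||||n nP] := dX (fun i u => u \in Y i).
- by move=> i; apply: submod_mem.
- by move=> i u; apply: decY.
- by move=> i u ->; apply: rpred0.
- by [].
exists n => k nk u; apply/idP/idP; last exact: nP.
exact: (@incl_dec _ X (fun i u => u \in Y i) decY).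
Qed.

Lemma tower_in xs X : tower xs X -> all (mem m) xs.
Proof.
elim: xs X => [|x xs IH] X //= [mx _ _ [Y [j [/IH xsm _ _]]]].
exact/andP.
Qed.

Lemma colon0_cons x xs X Y (j : {linear Y -> X}) : injective j ->
  (forall u, x *: u = 0 <-> exists y, j y = u) ->
  forall u, u \in colon0 X (x :: xs) <-> exists2 y, y \in colon0 Y xs & j y = u.
Proof.
move=> j_inj j_ker u; have jxs y : (j y \in colon0 X xs) = (y \in colon0 Y xs).
  rewrite !inE; apply: eq_all => a; rewrite -linearZ.
  by rewrite raddf_eq0.
split=> [/andP[/eqP/j_ker[y <-] ys]|[y ys <-]].
  by exists y; rewrite -?jxs.
apply/andP; split; first by apply/eqP/j_ker; exists y.
by rewrite -jxs in ys.
Qed.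

Lemma tower_coregular xs X : tower xs X -> coregular_seq m X xs.
Proof.
move=> tX; split; first exact: tower_in tX.
elim: xs X tX => [|x xs IH] X //= [_ divx _ [Y [j [/IH cY j_inj j_ker]]]].
case=> [|i] ilt u; first by move=> _; have [v] := divx u; exists v.
move=> /(colon0_cons _ j_inj j_ker)[y ysy <-]; have [z zs <-] := cY i ilt y ysy.
exists (j z); last by rewrite -linearZ.
by apply/(colon0_cons _ j_inj j_ker); exists z.
Qed.

(** Going down the tower, y would be surjective on the last kernel, where it is
    nilpotent. *)
Lemma tower_maximal xs X y : tower xs X -> y \in m ->
  ~ coregular_seq m X (rcons xs y).
Proof.
move=> tX my [_ /(_ (size xs))]; rewrite size_rcons leqnn => /(_ isT).
rewrite nth_rcons ltnn eqxx -cats1 take_size_cat //.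
elim: xs X tX => [|x xs IH] X /=.
  move=> [_ [l kX] [u0 nz]] divy; apply: nz.
  have yl k (u : X) : exists v, y ^+ k *: v = u.
    elim: k u => [|k IH] u; first by exists u; rewrite scale1r.
    have [v <-] := IH u; have [w _ <-] := divy v isT.
    by exists w; rewrite exprSr scalerA.
  by have [v <-] := yl l u0; apply: kills_expr my (kX v).
move=> [_ _ _ [Y [j [/IH cY j_inj j_ker]]]] divy; apply: cY => u xsu.
have /divy[v /(colon0_cons _ j_inj j_ker)[w xsw <-]] :
    j u \in colon0 X (x :: xs) by apply/(colon0_cons _ j_inj j_ker); exists u.
by rewrite -linearZ => /j_inj <-; exists w.
Qed.

Lemma tower_Ndim xs X : noetherian R^o -> local_ring m -> tower xs X ->
  is_Ndim X (size xs).
Proof.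
move=> nR lR tX; apply/is_NdimE; elim: xs X tX => [|x xs IH] X.
  by move=> [nX _ [u nz]]; split=> // /(_ u I).
move=> tX; have dX := tower_dcc nR lR tX.
case: tX => [_ divx tors [Y [j [/IH[ndY dY] j_inj j_ker]]]].
have h0 := submod_zerop X; have hX := submod_fullp X.
have dK r := dev_kernel j_inj j_ker r; split=> [/= dX'|].
  apply/ndY/dK; apply: dev_divisible dX' => // u _.
  by have [v <-] := divx u; exists v; rewrite // subrr; apply: is_submod0.
by apply: dev_torsion tors _ => //; apply/dK.
Qed.

Lemma tower_width xs X : tower xs X -> is_width m X (size xs).
Proof.
move=> tX; exists xs; split=> //; first exact: tower_coregular.
by move=> y; apply: tower_maximal.
Qed.

End Tower.

(** * Injective modules and mapping cones *)

Section Extension.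
Context {R : comNzRingType}.
Implicit Types (E V W : lmodType R).

(** Injectivity for partial linear maps: their domains are submodules of V, and
    passing to products needs no subtypes. *)
Definition extends_relations E : Prop :=
  forall V (g : V -> E -> Prop), linrel g -> (forall v, g 0 v -> v = 0) ->
    exists f : {linear V -> E}, forall u v, g u v -> f u = v.

Lemma injective_extends E : injective_module E -> extends_relations E.
Proof.
move=> injE V g lg sv; pose D u := exists v, g u v.
have hD : is_submod D.
  split=> [|a u u' [v guv] [v' guv']]; first by exists 0; apply: lg.1.
  by exists (a *: v + v'); apply: lg.2.
pose i : {linear submod (asbool_submod hD) -> V} := val.
have [|||f fP] := @linrel_fun R _ E (fun p v => g (i p) v).
- by split=> [|a u u' v v']; rewrite ?linear0 ?linearP; [apply: lg.1|apply: lg.2].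
- by move=> p; have /asbool_submodE := valP p.
- by move=> v; rewrite linear0; apply: sv.
have [h hP] := injE _ _ i f val_inj; exists h => u v guv.
have Du : u \in asbool_submod hD by apply/asbool_submodE; exists v.
have := hP (Submod Du); rewrite /= => ->.
apply/eqP; rewrite -subr_eq0; apply/eqP/sv; rewrite -(subrr u).
by apply: linrelB => //; apply: (fP (Submod Du)).
Qed.

Lemma extends_prod E F : extends_relations E -> extends_relations F ->
  extends_relations (E * F)%type.
Proof.
move=> extE extF V g lg sv.
have [||f1 f1P] := extE V (fun u v => exists w, g u (v, w)).
- split=> [|a u u' v v' [w gw] [w' gw']]; first by exists 0; apply: lg.1.
  by exists (a *: w + w'); apply: lg.2 gw gw'.
- by move=> v [w /sv[]].
have [||f2 f2P] := extF V (fun u w => exists v, g u (v, w)).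
- split=> [|a u u' v v' [w gw] [w' gw']]; first by exists 0; apply: lg.1.
  by exists (a *: w + w'); apply: lg.2 gw gw'.
- by move=> v [w /sv[]].
pose f u := (f1 u, f2 u).
have lf : linear f by move=> a u v; rewrite /f !linearP.
pose h : {linear V -> (E * F)%type} :=
  HB.pack f (GRing.isLinear.Build R _ _ _ f lf).
exists h => u [v w] guvw; rewrite /h /= /f; congr (_, _).
  by apply: f1P; exists w.
by apply: f2P; exists v.
Qed.

End Extension.

Section Cone.
Context {R : comNzRingType}.
Implicit Types C : cochain R.

(** Shifting by one degree gives degree 0 a predecessor, so that exactness in
    degree 0 is an instance of exactness in degree n. *)
Definition shift C n : lmodType R := if n is k.+1 then C k else 'rV[R]_0.

Lemma shift_extends C : (forall n, extends_relations (C n)) ->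
  forall n, extends_relations (shift C n).
Proof.
move=> extC [|n]; last exact: extC.
move=> V g lg sv; exists \0 => u v guv.
exact: etrans (thinmx0 _) (esym (thinmx0 _)).
Qed.

Definition pdiff C n : {linear shift C n -> C n} :=
  match n with 0%N => \0 | k.+1 => cochain_diff C k end.

Lemma pdiffK C n w : cochain_diff C n (pdiff C n w) = 0.
Proof. by case: n w => [|n] w; rewrite /= ?linear0 ?cochain_diffK. Qed.

Variables (x : R) (C : cochain R).

Definition cone_obj n : lmodType R := (C n * shift C n)%type.

Definition cone_fun n (p : cone_obj n) : cone_obj n.+1 :=
  (cochain_diff C n p.1, x *: p.1 - pdiff C n p.2).

Lemma cone_fun_linear n : linear (@cone_fun n).
Proof.
move=> a [u v] [u' v']; rewrite /cone_fun /=; congr (_, _); first exact: linearP.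
rewrite (linearP (pdiff C n)) scalerDr opprD addrACA /= scalerBr !scalerA.
by rewrite [x * a]mulrC.
Qed.
HB.instance Definition _ n :=
  GRing.isLinear.Build R _ _ _ (@cone_fun n) (@cone_fun_linear n).

Lemma cone_funK n p : @cone_fun n.+1 (@cone_fun n p) = 0.
Proof.
by rewrite /cone_fun /= cochain_diffK linearB linearZ /= pdiffK subr0 subrr.
Qed.

(** The mapping cone of multiplication by [x] on C, placed so that it computes
    the quotient by [x] one degree higher. *)
Definition cone : cochain R :=
  @Cochain R cone_obj (fun n => @cone_fun n) cone_funK.

Lemma cone_extends : (forall n, extends_relations (C n)) ->
  forall n, extends_relations (cone n).
Proof. by move=> extC n; apply: extends_prod => //; apply: shift_extends. Qed.

End Cone.

Section Resolution.
Context {R : comNzRingType} (M : lmodType R).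
Implicit Types (C : cochain R) (S : M -> Prop).

Definition exact_at C n : Prop :=
  forall u : C n, cochain_diff C n u = 0 -> exists w, pdiff C n w = u.

(** C consists of injective modules and its only cohomology module is M / S,
    in degree s. *)
Definition resolves C s S : Prop :=
  exists iota : {linear M -> C s},
    [/\ forall n, extends_relations (C n), forall n, n != s -> exact_at C n,
        forall u, cochain_diff C s (iota u) = 0,
        forall z, cochain_diff C s z = 0 ->
          exists u w, z = iota u + pdiff C s w &
        forall u, (exists w, pdiff C s w = iota u) <-> S u].

Lemma injective_resolution_resolves (I : cochain R) (e : {linear M -> I 0%N}) :
  injective_resolution e -> resolves I 0 (zerop M).
Proof.
move=> [injI e_inj ex0 exS]; exists e; split.
- by move=> n; apply/injective_extends/injI.
- move=> [//|n] _ u /eqP du; have := exS n u; rewrite !inE du.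
  by move=> /esym/asboolP[w]; exists w.
- move=> u; have := ex0 (e u); rewrite !inE => H; apply/eqP; rewrite H.
  by apply/asboolP; exists u.
- move=> z /eqP dz; have := ex0 z; rewrite !inE dz => /esym/asboolP[u <-].
  by exists u, 0; rewrite addr0.
- move=> u; split=> [[w /= /esym/eqP]|->]; last by exists 0; rewrite !linear0.
  by rewrite raddf_eq0 // => /eqP.
Qed.

(** Regularity of x on M / S is what makes the cone exact in degree s: if
    x u is a boundary, so is u. *)
Lemma cone_resolves x C s S : is_submod S -> (forall u, S (x *: u) -> S u) ->
  resolves C s S -> resolves (cone x C) s.+1 (adj S x).
Proof.
move=> hS reg [iota [extC exC dio cyc bd]].
have lio : linear (fun u => (0, iota u) : cone x C s.+1).
  by move=> a u v; rewrite linearP; congr (_, _); rewrite /= scaler0 addr0.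
pose iota' : {linear M -> cone x C s.+1} :=
  HB.pack (fun u => (0, iota u) : cone x C s.+1)
    (GRing.isLinear.Build R _ _ _ _ lio).
exists iota'; split.
- exact: cone_extends.
- move=> n ns [u v] [/= du /eqP]; rewrite subr_eq0 => /eqP xu.
  have [u' u'E] : exists u', pdiff C n u' = u.
    have [ns'|] := eqVneq n s; last by move=> /exC; apply.
    subst n; have [k [w uE]] := cyc u du; rewrite uE in xu *.
    suff /reg/bd[w' <-] : S (x *: k) by exists (w' + w); rewrite linearD.
    apply/bd; exists (v - x *: w).
    by rewrite linearB !linearZ /= -xu scalerDr scalerN addrK.
  case: n ns u v du xu u' u'E => [|n] ns u v du xu u' u'E.
    exists 0; rewrite linear0 -u'E; congr (_, _); exact: esym (thinmx0 _).
  have [||v' v'E] := exC n _ (x *: u' - v); first by rewrite -eqSS.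
    apply/eqP; rewrite linearB linearZ subr_eq0 /=.
    by rewrite -[cochain_diff C n u']/(pdiff C n.+1 u') u'E xu.
  exists (u', v'); congr (_, _) => //=.
  by rewrite v'E opprB addrC subrK.
- move=> u; congr (_, _); first exact: linear0.
  by rewrite /= dio scaler0 subr0.
- move=> [u v] [/= du /eqP]; rewrite subr_eq0 => /eqP xu.
  have [|u' u'E] := exC s.+1 _ u du; first by rewrite gtn_eqF.
  have [|k [w wE]] := cyc (x *: u' - v).
    apply/eqP; rewrite linearB linearZ subr_eq0 /=.
    by rewrite -[cochain_diff C s u']/(pdiff C s.+1 u') u'E xu.
  exists (- k), (u', w); congr (_, _); first by rewrite add0r.
  rewrite /= linearN -[x *: u'](subrK v) wE.
  by rewrite [_ + v - _]addrAC addrK addKr.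
- move=> u; split=> [[[u' v']] [/= du' iE]|[k /bd[w wE]]].
    have [k [w u'E]] := cyc u' du'; exists k; apply/bd; exists (x *: w - v').
    rewrite !linearB !linearZ /= -iE u'E scalerDr.
    by rewrite [RHS]addrAC [x *: iota k + _]addrC ?scalerN addrK.
  exists (iota k, - w); congr (_, _); first exact: dio.
  by rewrite /= linearN opprK wE linearB [iota (x *: k)]linearZ addrC subrK.
Qed.

(** The next homotopy is defined on the boundaries d u by
    d u |-> u - d (h u), which is well defined by exactness, and extends to the
    whole module by injectivity. *)
Lemma contraction C s : (forall n, extends_relations (C n)) ->
  (forall n, (n < s)%N -> exact_at C n) ->
  exists h : {linear C s -> shift C s}, forall w,
    pdiff C s (h (pdiff C s w)) = pdiff C s w.
Proof.
move=> extC; elim: s => [|s IH] exC; first by exists \0.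
have [|h hP] := IH; first by move=> n /ltnW; apply: exC.
pose g (z : C s.+1) (v : C s) :=
  exists2 u, cochain_diff C s u = z & v = u - pdiff C s (h u).
have [||h' h'P] := extC s _ g.
- split=> [|a z z' v v' [u <- ->] [u' <- ->]].
    exists 0; first exact: linear0.
    by rewrite (linear0 h) (linear0 (pdiff C s)) subr0.
  exists (a *: u + u'); first exact: linearP.
  by rewrite (linearP h) (linearP (pdiff C s)) scalerBr opprD addrACA.
- move=> v [u /(exC s (ltnSn s))[w <-] ->]; rewrite hP; exact: subrr.
exists h' => w /=; rewrite (h'P _ (w - pdiff C s (h w))); last by exists w.
by rewrite linearB pdiffK subr0.
Qed.

End Resolution.

(** * Local cohomology of a mapping cone *)

Section LocalCohomology.
Context {R : comNzRingType} (m : idealr R).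
Implicit Types (C : cochain R) (V W : lmodType R).

Lemma torsion_map V W (f : {linear V -> W}) v :
  v \in torsion m V -> f v \in torsion m W.
Proof.
move=> /torsionP[k kv]; apply/torsionP; exists k.
by apply: kills_map kv => u ->; apply: linear0.
Qed.

Lemma torsion_pair V W (u : V) (v : W) :
  ((u, v) : (V * W)%type) \in torsion m (V * W)%type <->
  u \in torsion m V /\ v \in torsion m W.
Proof.
split=> [tuv|[tu tv]].
  split; first exact: (torsion_map fst tuv).
  exact: (torsion_map snd tuv).
have l1 : linear (fun u : V => (u, 0) : (V * W)%type).
  by move=> a b c; congr (_, _); rewrite /= scaler0 addr0.
have l2 : linear (fun v : W => (0, v) : (V * W)%type).
  by move=> a b c; congr (_, _); rewrite /= scaler0 addr0.
pose f1 : {linear V -> (V * W)%type} :=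
  HB.pack (fun u : V => (u, 0) : (V * W)%type)
    (GRing.isLinear.Build R _ _ _ _ l1).
pose f2 : {linear W -> (V * W)%type} :=
  HB.pack (fun v : W => (0, v) : (V * W)%type)
    (GRing.isLinear.Build R _ _ _ _ l2).
have -> : ((u, v) : (V * W)%type) = f1 u + f2 v.
  by congr (_, _); rewrite /= ?addr0 ?add0r.
by apply: rpredD; apply: torsion_map.
Qed.

Definition torsion_cocycle C n (z : C n) : Prop :=
  z \in torsion m (C n) /\ cochain_diff C n z = 0.

Definition torsion_boundary C n (z : C n) : Prop :=
  exists2 w, w \in torsion m (shift C n) & pdiff C n w = z.

Definition vanishes C n : Prop :=
  forall z : C n, torsion_cocycle z -> torsion_boundary z.

(** Cohomology classes and the torsion cocycles that represent them. *)
Definition lc_rel C n (z : C n) (h : local_cohomology m C n) : Prop :=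
  exists2 p : submod (torsion m (C n)), val p = z & subquot_rel p h.

Lemma lc_rel_linrel C n : linrel (@lc_rel C n).
Proof.
have lg := subquot_rel_linrel (ker_submod (cochain_diff (torsion_cochain m C) n))
  (boundaries (torsion_cochain m C) n).
split; first by exists 0 => //; apply: lg.1.
move=> a u u' v v'; intros [p pu ph] [q qu qh].
by exists (a *: p + q); [rewrite -pu -qu | apply: lg.2].
Qed.

Lemma lc_rel_cocycle C n (z : C n) h : lc_rel z h -> torsion_cocycle z.
Proof.
intros [p pz ph]; subst z; have := subquot_rel_dom ph; rewrite inE => /eqP dp.
by split; [exact: valP | have := congr1 val dp].
Qed.

Lemma lc_rel_ex C n (z : C n) : torsion_cocycle z -> exists h, lc_rel z h.
Proof.
move=> [tz dz]; pose p : submod (torsion m (C n)) := Submod tz.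
have [|h ph] := @subquot_rel_ex _ _
  (ker_submod (cochain_diff (torsion_cochain m C) n))
  (boundaries (torsion_cochain m C) n) p.
  by rewrite inE; apply/eqP/val_inj.
by exists h, p.
Qed.

Lemma lc_rel_surj C n (h : local_cohomology m C n) : exists z, lc_rel z h.
Proof. by have [p ph] := subquot_rel_surj h; exists (val p), p. Qed.

Lemma lc_rel0 C n (z : C n) h : lc_rel z h -> h = 0 <-> torsion_boundary z.
Proof.
intros [p pz ph]; subst z; rewrite (subquot_rel0 ph) {ph}.
case: n h p => [|n] h p /=.
  rewrite inE; split=> [/eqP->|[w _ /= /esym p0]].
    by exists 0; [exact: rpred0 | rewrite !linear0].
  by apply/eqP/val_inj.
rewrite inE; split=> [/asboolP[w <-]|[w tw wp]].
  by exists (val w); [exact: valP|].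
by apply/asboolP; exists (Submod tw); apply: val_inj.
Qed.

(* From here on cohomology classes are handled only through lc_rel. *)
Local Opaque local_cohomology.

Lemma lc_rel_torsion C n (h : local_cohomology m C n) :
  exists k, kills m k (zerop _) h.
Proof.
have [z zh] := lc_rel_surj h; have [/torsionP[k kz] _] := lc_rel_cocycle zh.
exists k; apply: (kills_rel (lc_rel_linrel C n)) zh kz => {h}z h zh z0.
by apply/(lc_rel0 zh); exists 0; rewrite ?rpred0 // z0 linear0.
Qed.

Section ConeSequence.
Variables (x : R) (C : cochain R).
Hypothesis mx : x \in m.

Lemma cone_cocycleP n (u : C n) (v : shift C n) :
  torsion_cocycle ((u, v) : cone x C n) <->
  [/\ u \in torsion m (C n), v \in torsion m (shift C n),
      cochain_diff C n u = 0 & x *: u = pdiff C n v].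
Proof.
split=> [[/torsion_pair[tu tv] [du /eqP]]|[tu tv du xu]].
  by rewrite subr_eq0 => /eqP.
split; first exact/torsion_pair.
by congr (_, _); rewrite //= xu subrr.
Qed.

Lemma torsion_boundary_fst n (u : C n) (v : shift C n) :
  torsion_boundary ((u, v) : cone x C n) -> torsion_boundary u.
Proof.
case: n u v => [|n] u v [w tw] /=.
  by move=> [<- _]; exists 0; rewrite ?rpred0 ?linear0.
by case: w tw => w1 w2 /torsion_pair[tw1 _] [<- _]; exists w1.
Qed.

Lemma torsion_boundary_divide n (z : C n) : vanishes (cone x C) n ->
  torsion_cocycle z -> torsion_boundary (x *: z) -> torsion_boundary z.
Proof.
move=> van [tz dz] [w tw wz].
by apply: (@torsion_boundary_fst n z w); apply: van; apply/cone_cocycleP.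
Qed.

(** A power of x kills z, and z is a boundary as soon as x z is one: if
    x z = d w, the cocycle (z, w) of the cone is a boundary. *)
Lemma vanishes_cone n : vanishes (cone x C) n -> vanishes C n.
Proof.
move=> van z zc; have [/torsionP[k /(kills_expr mx) xz] dz] := zc.
have {xz} : torsion_boundary (x ^+ k *: z).
  by exists 0; rewrite ?rpred0 // xz linear0.
elim: k => [|k IH]; first by rewrite scale1r.
rewrite exprS -scalerA => /(torsion_boundary_divide van) xb; apply/IH/xb.
split; first by apply: rpredZ; case: zc.
by rewrite linearZ dz; apply: scaler0.
Qed.

(** For a torsion cocycle z the cocycle (0, z) of the cone is the boundary of
    some (u, v), which says that z = x u - d v. *)
Lemma lc_divisible n : vanishes (cone x C) n.+1 ->
  forall h : local_cohomology m C n, exists h', x *: h' = h.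
Proof.
move=> van h; have [z zh] := lc_rel_surj h; have [tz dz] := lc_rel_cocycle zh.
have [|[u v] tw [du zE]] := van ((0, z) : cone x C n.+1).
  by apply/cone_cocycleP; rewrite rpred0 linear0 scaler0.
have /torsion_pair[tu tv] := tw.
have [h' uh'] : exists h', lc_rel u h' by apply: lc_rel_ex.
exists h'; apply/eqP; rewrite -subr_eq0; apply/eqP.
have lg := lc_rel_linrel C n.
have : lc_rel (x *: u - z) (x *: h' - h).
  by apply: linrelB => //; apply: linrelZ.
move=> /lc_rel0 ->; exists v => //.
by move: zE => /= <-; rewrite opprB addrC subrK.
Qed.

(** The map is induced by (u, v) |-> u.  A cocycle (u, v) of the cone means
    x u = d v, so the image is the kernel of x.  If u = d u', then x u' - v is a
    cocycle, hence a boundary d v', and (u, v) is the boundary of (u', v'). *)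
Lemma lc_kernel n : vanishes C n ->
  exists j : {linear local_cohomology m (cone x C) n.+1 ->
              local_cohomology m C n.+1},
    injective j /\ forall h, x *: h = 0 <-> exists h', j h' = h.
Proof.
move=> van.
have lg := lc_rel_linrel C n.+1; have lg' := lc_rel_linrel (cone x C) n.+1.
pose g h' h := exists u v,
  lc_rel ((u, v) : cone x C n.+1) h' /\ lc_rel u h.
have cocycle_fst u v : torsion_cocycle ((u, v) : cone x C n.+1) ->
    torsion_cocycle u.
  by move=> /cone_cocycleP[tu _ du _].
have [|||j jP] := @linrel_fun _ _ _ g.
- split=> [|a h1 h2 k1 k2 [u [v [gh gk]]] [u' [v' [gh' gk']]]].
    by exists 0, 0; split; [apply: lg'.1 | apply: lg.1].
  exists (a *: u + u'), (a *: v + v'); split; last exact: lg.2.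
  exact: (lg'.2 a _ _ _ _ gh gh').
- move=> h'; have [[u v] uvh'] := lc_rel_surj h'.
  have [|h uh] := @lc_rel_ex C n.+1 u.
    exact: cocycle_fst (lc_rel_cocycle uvh').
  by exists h, u, v.
- move=> h [u [v [uv0 uh]]]; apply/(lc_rel0 uh).
  exact: torsion_boundary_fst ((lc_rel0 uv0).1 erefl).
exists j; split.
  suff j0 h' : j h' = 0 -> h' = 0.
    move=> h1 h2 jh; apply/eqP; rewrite -subr_eq0; apply/eqP/j0.
    by rewrite linearB jh subrr.
  have [u [v [uvh' uh]]] := jP h'; move=> /(lc_rel0 uh)[u' tu' /= u'E].
  have [tu tv _ xu] := (cone_cocycleP _ _).1 (lc_rel_cocycle uvh').
  have [|v' tv' v'E] := van (x *: u' - v).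
    split; first by apply: rpredB => //; apply: rpredZ.
    by apply/eqP; rewrite linearB linearZ subr_eq0 /= u'E xu.
  apply/(lc_rel0 uvh'); exists (u', v'); first exact/torsion_pair.
  by congr (_, _) => //=; rewrite v'E opprB addrC subrK.
move=> h; split=> [xh|[h' <-]].
  have [u uh] := lc_rel_surj h; have [tu du] := lc_rel_cocycle uh.
  have xuh : lc_rel (x *: u) (x *: h) by apply: linrelZ.
  have [v tv vE] := (lc_rel0 xuh).1 xh.
  have [|h' uvh'] := @lc_rel_ex (cone x C) n.+1 (u, v).
    exact/cone_cocycleP.
  exists h'; have [u2 [v2 [uvh2 uh2]]] := jP h'.
  apply/eqP; rewrite -subr_eq0; apply/eqP.
  have := linrelB lg uh2 uh => /lc_rel0 ->.
  apply: (@torsion_boundary_fst n.+1 _ (v2 - v)).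
  exact: (lc_rel0 (linrelB lg' uvh2 uvh')).1 (subrr _).
have [u [v [uvh' uh]]] := jP h'.
have xuh : lc_rel (x *: u) (x *: j h') by apply: linrelZ.
apply/(lc_rel0 xuh).
have [_ tv _ ->] := (cone_cocycleP _ _).1 (lc_rel_cocycle uvh').
by exists v.
Qed.

End ConeSequence.

End LocalCohomology.

(** * Top local cohomology of a Cohen-Macaulay module *)

Section CohenMacaulay.
Context {R : comNzRingType} (m : idealr R) (M : lmodType R).
Implicit Types (C : cochain R) (S : M -> Prop).

Local Opaque local_cohomology.

(** A contraction is linear, so it maps torsion to torsion. *)
Lemma vanishes_below C s : (forall n, extends_relations (C n)) ->
  (forall n, (n < s)%N -> exact_at C n) ->
  forall n, (n < s)%N -> vanishes m C n.
Proof.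
move=> extC exC n ns z [tz dz]; have [w wz] := exC n ns z dz.
have [|h hP] := contraction (s := n) extC.
  by move=> k kn; apply: exC; apply: ltn_trans ns.
exists (h z); first exact: torsion_map.
by rewrite -wz hP.
Qed.

Section LastTerm.
Variables (C : cochain R) (s : nat) (S : M -> Prop) (l : nat).
Hypothesis hS : is_submod S.
Hypothesis kS : forall u, kills m l S u.
Hypothesis resC : resolves C s S.

Let im (z : C s) := exists w, pdiff C s w = z.

(** The map z |-> z - d (h z) is linear and vanishes on the boundaries, so a
    power of m that sends z to the boundaries kills the image of z. *)
Let torsion_correct (h : {linear C s -> shift C s}) k z :
  (forall w, pdiff C s (h (pdiff C s w)) = pdiff C s w) ->
  kills m k im z -> z - pdiff C s (h z) \in torsion m (C s).
Proof.
move=> hP kz; apply/torsionP; exists k.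
have lf : linear (fun z => z - pdiff C s (h z)).
  move=> a u v; rewrite (linearP h) (linearP (pdiff C s)).
  by rewrite opprD addrACA scalerBr.
pose f : {linear C s -> C s} := HB.pack (fun z => z - pdiff C s (h z))
  (GRing.isLinear.Build R _ _ _ _ lf).
apply: (kills_map (f := f)) kz => _ [w <-].
by rewrite /zerop /= hP subrr.
Qed.

(** Write z = d w.  A power of m kills z, so it sends w to the cocycles, and
    m ^ l sends these to the boundaries.  So w can be corrected by a boundary to
    become torsion. *)
Lemma vanishes_above : vanishes m C s.+1.
Proof.
have [iota [extC exC dio cyc bd]] := resC.
move=> z [/torsionP[k kz] dz].
have [|w wz] := exC s.+1 _ z dz; first by rewrite gtn_eqF.
have [|h hP] := contraction (s := s) extC.
  by move=> n ns; apply: exC; rewrite ltn_eqF.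
exists (w - pdiff C s (h w)); last by rewrite linearB /= pdiffK subr0.
apply: (torsion_correct (k := k + l)) => //; apply: killsD.
have lg : linrel (fun z w => z = cochain_diff C s w).
  by split=> [|a u u' v v' -> ->]; rewrite ?linear0 ?linearP.
apply: (kills_rel lg) (esym wz) kz => _ v -> dv.
have [u [w' ->]] := cyc v dv; have him : is_submod im.
  split=> [|a b b' [y <-] [y' <-]]; first by exists 0; rewrite linear0.
  by exists (a *: y + y'); rewrite linearP.
apply: is_submodD; first exact: submod_kills.
  by apply: kills_map (kS u) => b /bd.
by apply: (kills_leq (k := 0)) => //; exists w'.
Qed.

(** The local cohomology is the image of M under u |-> iota u - d (h (iota u)),
    which corrects the cocycle iota u into a torsion one; the kernel is S. *)
Lemma tower_last : noetherian M -> (exists u, ~ S u) ->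
  tower m [::] (local_cohomology m C s).
Proof.
move=> nM [u0 nSu0]; have [iota [extC exC dio cyc bd]] := resC.
have [|h hP] := contraction (s := s) extC.
  by move=> n ns; apply: exC; rewrite ltn_eqF.
pose tau u := iota u - pdiff C s (h (iota u)).
have ltau a u v : tau (a *: u + v) = a *: tau u + tau v.
  rewrite /tau (linearP iota) (linearP h) (linearP (pdiff C s)).
  by rewrite opprD addrACA scalerBr.
have tau_cocycle u : torsion_cocycle m (tau u).
  split; last by rewrite linearB dio pdiffK subr0.
  by apply: (torsion_correct (k := l)) => //; apply: kills_map (kS u) => v /bd.
pose g u H := lc_rel (m := m) (tau u) H.
have lg : linrel g.
  have lr := lc_rel_linrel m C s; split=> [|a u u' v v' gu gu'].
    rewrite /g /tau (linear0 iota) (linear0 h) (linear0 (pdiff C s)) subr0.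
    exact: lr.1.
  by rewrite /g ltau; apply: lr.2.
have g0 u H : g u H -> S u <-> H = 0.
  move=> guH; have gE := lc_rel0 guH; rewrite gE; split=> [/bd[w wE]|[w _ wE]].
    exists 0; rewrite ?rpred0 //.
    by rewrite /tau -wE hP subrr linear0.
  apply/bd; exists (w + h (iota u)).
  by rewrite linearD wE subrK.
have gsurj H : exists u, g u H.
  have [z zH] := lc_rel_surj H; have [tz dz] := lc_rel_cocycle zH.
  have [u [w zE]] := cyc z dz; exists u.
  have [H' uH'] := lc_rel_ex (tau_cocycle u).
  suff HH : H' - H = 0.
    by rewrite /g -[H](subrK H') -[H - H']opprB HH oppr0 add0r.
  apply/(lc_rel0 (linrelB (lc_rel_linrel m C s) uH' zH)).
  set b := tau u - z.
  have [y yb] : im b.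
    exists (- h (iota u) - w); rewrite linearB linearN /b /tau zE.
    by rewrite opprD addrACA subrr add0r.
  exists (h b); last by rewrite -yb hP.
  by apply: torsion_map; apply: rpredB => //; case: (tau_cocycle u).
split.
- apply: (dev_subquot lg) nM => //; try exact: submod_zerop.
    by move=> H _; have [u] := gsurj H; exists u.
  by move=> u H guH u0E _; apply/(g0 _ _ guH); rewrite u0E; apply: is_submod0.
- exists l => H; have [u guH] := gsurj H.
  by apply: (kills_rel lg) guH (kS u) => v H' /g0[].
- have [H u0H] := lc_rel_ex (tau_cocycle u0); exists H => H0.
  exact/nSu0/(g0 _ _ u0H).
Qed.

End LastTerm.

(** Each step replaces C by a cone, s by s + 1 and S by S + y M, so that
    s + size ys, the degree in which the tower lives, stays equal to d.  The two
    neighbouring vanishings are carried along, as each step of the long exact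
    sequence uses them. *)
Lemma tower_local_cohomology d C s S ys l : is_submod S ->
  resolves C s S -> regular_mod S ys -> all (mem m) ys ->
  (forall u, kills m l (foldl (@adj R M) S ys) u) ->
  (exists u, ~ foldl (@adj R M) S ys u) -> noetherian M ->
  d = (s + size ys)%N ->
  [/\ tower m ys (local_cohomology m C d),
      forall n, n.+1 = d -> vanishes m C n & vanishes m C d.+1].
Proof.
move=> hS resC reg mys kS nS nM.
elim: ys C s S hS resC reg mys kS nS => [|y ys IH] C s S hS resC.
  move=> _ _ kS nS; rewrite addn0 => ->; split.
  - exact: (tower_last (l := l) (S := S)).
  - case: resC => iota [extC exC _ _ _] n ns.
    apply: (vanishes_below (s := s) extC); last by rewrite -ns.
    by move=> k ks; apply: exC; rewrite ltn_eqF.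
  - exact: vanishes_above kS resC.
move=> /= [regy reg] /andP[my mys] kS nS; rewrite addnS => dE.
have [|||||||tY belowY aboveY] := IH (cone y C) s.+1 (adj S y); rewrite ?addSn //.
- exact: submod_adj.
- exact: cone_resolves.
case: d dE {IH} tY belowY aboveY => // n dE tY belowY aboveY.
have belowC k : k.+1 = n.+1 -> vanishes m C k.
  by move=> /belowY; apply: vanishes_cone.
split=> //; last exact: vanishes_cone aboveY.
have [j [j_inj j_ker]] := lc_kernel y (belowC n erefl).
split=> //.
- exact: lc_divisible aboveY.
- by move=> u _; have [k /(kills_expr my)] := lc_rel_torsion u; exists k.
- by exists (local_cohomology m (cone y C) n.+1), j.
Qed.

End CohenMacaulay.

Theorem proposition2p6 (R : comNzRingType) (m : idealr R) (M : lmodType R)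
    (d : nat) (I : cochain R) (e : {linear M -> I 0%N}) :
  local_ring m ->
  noetherian_ring R ->
  finitely_generated M ->
  (exists u : M, u != 0) ->
  is_krull_dim M d ->
  cohen_macaulay m M ->
  injective_resolution e ->
  [/\ co_cohen_macaulay m (local_cohomology m I d),
      is_width m (local_cohomology m I d) d
    & is_Ndim (local_cohomology m I d) d].
Proof.
move=> lR /noetherian_regular nR fgM _ dimM [n [[xs [regxs _ sxs]] dimMn]] resI.
have dE : d = size xs.
  rewrite sxs; apply/eqP; rewrite eqn_leq.
  by rewrite dimMn.2 ?dimM.2 //; [case: dimMn | case: dimM].
have nM := noetherian_fg nR fgM.
have reg := regular_seq_mod regxs; have [mxs _ [u nu]] := regxs.
have [|l kM] := system_kills nR lR _ reg; first by rewrite -dE.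
have [||||||||tI _ _] :=
  @tower_local_cohomology _ m M d I 0 (zerop M) xs l; rewrite //.
- exact: submod_zerop.
- exact: injective_resolution_resolves resI.
- by exists u; rewrite -in_ideal_mulE.
have wI := tower_width tI; have NI := tower_Ndim nR lR tI.
have aI := dcc_artinian (tower_dcc nR lR tI).
by rewrite -dE in wI NI; split=> //; split=> //; exists d.
Qed.
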